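(* Let $\ell\ge1$, $n\ge 1$, and let $X$ be the module afforded by a Weil representation of $\mathrm{U}=\mathrm{U}(V,h)$ of type $\lambda$, where $\lambda$ is a primitive linear character of $R^+$. The dimensions of the irreducible constituents of $X$ under $\mathrm{U}$ are $$ \frac{q^{(2\ell-1)n}-q^{(2\ell-3)n}}{2q^{\ell-1}},\ \frac{q^{(2\ell-3)n}-q^{(2\ell-5)n}}{2q^{\ell-2}},\ \dots,\ \frac{q^{3n}-q^{n}}{2q},\ \frac{q^n\pm 1}{2}. $$ More precisely, if $\ell=1$ these dimensions are $\frac{q^n\pm 1}{2}$, while if $\ell>1$ then the dimensions of the irreducible constituents of $\mathrm{Top}$ under $\mathrm{U}$ are all equal to $$ \frac{\dim \mathrm{Top}}{|N|}=\frac{q^{(2\ell-1)n}-q^{(2\ell-3)n}}{2q^{\ell-1}}, $$ and the remaining dimensions in the list correspond to the irreducible constituents of $\mathrm{Bot}$ under $\mathrm{U}$.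
   Context: Rings. Let $\mathcal{O}$ be a local principal ideal domain that is not a field, with maximal ideal $\mathcal{O}s$ and finite residue field $F_q$ of odd characteristic. Let $\mathcal{R}=\mathcal{O}[X]/(X^2-s)=\mathcal{O}\oplus\mathcal{O}t$, $t^2=s$, with the involution fixing $\mathcal{O}$ elementwise and sending $t\mapsto -t$. Fix $\ell\ge 1$ and set $A=\mathcal{R}/\mathcal{R}t^{2\ell-1}$, $R=\mathcal{O}/\mathcal{O}s^{\ell}$. Let $\pi$ be the image of $t$ in $A$, $p$ the image of $s$ in $R$, $\mathfrak{r}=A\pi$, $\mathfrak{m}=Rp$. Then $R$ embeds in $A$, $A=R\oplus R\pi$, $\pi^2=p$, and $A$ has an induced involution $*$ fixing $R$ elementwise and sending $\pi\mapsto-\pi$. Put $\mathfrak{n}=\mathfrak{m}^{\ell-1}=\mathfrak{r}^{2\ell-2}$ (the minimal ideal of both $R$ and $A$) and $N=\{a\in A^\times\mid aa^*=1\}$. Forms. $V$ is a free $A$-module of rank $2n$, $n\ge 1$, and $h:V\times V\to A$ is a nondegenerate skew hermitian form: $h$ is $A$-linear in the second variable, $*$-linear in the first, $h(v,u)=-h(u,v)^*$, and $u\mapsto h(u,-)$ is an injective map $V\to\mathrm{Hom}_A(V,A)$. $\mathrm{U}=\mathrm{U}(V,h)$ is the group of all $g\in\mathrm{GL}_A(V)$ preserving $h$. Put $f(v,w)=\frac{h(v,w)+h(v,w)^*}{2}\in R$; this is a nondegenerate alternating $R$-bilinear form on $V$. $\mathrm{Sp}=\mathrm{Sp}(V,f)$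 is the group of all $g\in\mathrm{GL}_R(V)$ preserving $f$; thus $\mathrm{U}\le\mathrm{Sp}$. Weil representations. A linear character $\lambda:R^+\to\mathbb{C}^\times$ is primitive if its kernel contains no nonzero ideal of $R$. The Heisenberg group is $H=R\times V$ with $(r,u)(s,v)=(r+s+f(u,v),u+v)$ and center $(R,0)$, identified with $R^+$. Up to isomorphism $H$ has a unique irreducible complex representation $S:H\to\mathrm{GL}(X)$ on which $(R,0)$ acts via $\lambda$ (Schrödinger representation of type $\lambda$); its dimension is $\sqrt{|V|}$. For a subgroup $G\le\mathrm{Sp}$, a Weil representation of $G$ of type $\lambda$ is any representation $W:G\to\mathrm{GL}(X)$ with $W(g)S(r,u)W(g)^{-1}=S(r,gu)$ for all $g\in G$, $(r,u)\in H$. (Such representations exist, and any two differ by a linear character of $G$.) Layers ($\ell>1$). $\mathrm{Bot}=\{x\in X\mid S(0,w)x=x\text{ for all }w\in\mathfrak{n}V\}$, a $\mathrm{U}$-submodule of $X$, and $\mathrm{Top}=X/\mathrm{Bot}$. *)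

(* Defs.v *)
From HB Require Import structures.
From mathcomp Require Import all_boot all_order all_algebra all_fingroup.
From mathcomp Require Import mxrepresentation.

Set Implicit Arguments.
Unset Strict Implicit.
Unset Printing Implicit Defensive.

Import GRing.Theory.
Local Open Scope ring_scope.

(* Ideals here may be improper, unlike those of ring_quotient. *)
Definition is_ideal (T : comNzRingType) (I : T -> Prop) : Prop :=
  [/\ I 0, (forall x y, I x -> I y -> I (x + y))
         & (forall a x, I x -> I (a * x))].

Definition multiples (T : comNzRingType) (a : T) : T -> Prop :=
  fun x => exists y, x = y * a.

Definition principal_ideal_ring (T : comNzRingType) : Prop :=
  forall I : T -> Prop, is_ideal I ->
  exists a, forall x, I x <-> multiples a x.

Definition maximal_ideal (T : comNzRingType) (I : T -> Prop) : Prop :=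
  [/\ is_ideal I, ~ I 1
    & forall J : T -> Prop, is_ideal J -> ~ J 1 ->
      (forall x, I x -> J x) -> forall x, J x -> I x].

Definition local_with_maximal_ideal (T : comNzRingType) (m : T -> Prop) : Prop :=
  maximal_ideal m /\
  forall J : T -> Prop, maximal_ideal J -> forall x, J x <-> m x.

(* phi identifies T with the quotient ring S / I. *)
Definition quotient_map (S T : nzRingType) (I : S -> Prop) (phi : S -> T) : Prop :=
  (forall y, exists x, phi x = y) /\ (forall x, phi x = 0 <-> I x).

(* O[X]/(X^2 - s); the image t of X is 'qX, and O embeds in it by qpolyC. *)
Notation ramified s := {poly %/ ('X^2 - s%:P)}.

Definition norm_one (A : finComUnitRingType) (star : A -> A) : {set A} :=
  [set a | (a \is a GRing.unit) && (a * star a == 1)].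

Section Forms.

Variables (A : finComUnitRingType) (V : finLmodType A).
Implicit Types (star : A -> A) (h : V -> V -> A).

Definition free_of_rank (m : nat) : Prop :=
  exists e : 'I_m -> V,
    bijective (fun c : {ffun 'I_m -> A} => \sum_i c i *: e i).

Definition nondegenerate_skew_hermitian star h : Prop :=
  [/\ forall u a v w, h u (a *: v + w) = a * h u v + h u w,
      forall u v a w, h (a *: u + v) w = star a * h u w + h v w,
      forall u v, h v u = - star (h u v)
    & forall u v, h u =1 h v -> u = v].

Definition unitary_set h : {set {perm V}} :=
  [set g : {perm V} |
    [forall a, forall u, forall v, g (a *: u + v) == a *: g u + g v]
    && [forall u, forall v, h (g u) (g v) == h u v]].

Lemma unitaryP h (g : {perm V}) :
  reflect ((forall a u v, g (a *: u + v) = a *: g u + g v)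
           /\ (forall u v, h (g u) (g v) = h u v))
          (g \in unitary_set h).
Proof.
rewrite inE; apply: (iffP andP) => [] [gl gh]; split.
- by move=> a u v; have /forallP/(_ a)/forallP/(_ u)/forallP/(_ v)/eqP := gl.
- by move=> u v; have /forallP/(_ u)/forallP/(_ v)/eqP := gh.
- by apply/forallP=> a; apply/forallP=> u; apply/forallP=> v; rewrite gl.
- by apply/forallP=> u; apply/forallP=> v; rewrite gh.
Qed.

Lemma unitary_group_set h : group_set (unitary_set h).
Proof.
apply/group_setP; split.
  by apply/unitaryP; split=> *; rewrite !perm1.
move=> x y /unitaryP[xl xh] /unitaryP[yl yh]; apply/unitaryP.
by split=> *; rewrite !permM ?xl ?yl // yh xh.
Qed.

Canonical unitary_group h : {group {perm V}} := Group (unitary_group_set h).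

(* h + h* takes values in the image of R, and its preimage under the embedding
   iota is unique; the default 0 is never used. *)
Definition alternating_part (R : finComUnitRingType) (iota : R -> A) star h
    (v w : V) : R :=
  odflt 0 [pick r | iota r == (h v w + star (h v w)) / 2].

End Forms.

Definition primitive_character (R : comNzRingType) (C : fieldType)
    (lam : R -> C) : Prop :=
  [/\ lam 0 = 1, forall a b, lam (a + b) = lam a * lam b
    & forall I : R -> Prop, is_ideal I -> (forall x, I x -> lam x = 1) ->
      forall x, I x -> x = 0].

Section Weil.

Variables (R A : finComUnitRingType) (V : finLmodType A) (C : fieldType).
Variable d : nat.
Implicit Types (f : V -> V -> R) (S : R * V -> 'M[C]_d).

Definition heisenberg_mul f (a b : R * V) : R * V :=
  (a.1 + b.1 + f a.2 b.2, a.2 + b.2).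

(* X = 'rV[C]_d, and a matrix M stands for the operator x |-> x *m M, so that
   the composite of operators M o N is the matrix N *m M. *)
Definition schroedinger_repr f (lam : R -> C) S : Prop :=
  [/\ S (0, 0) = 1%:M,
      forall a b, S (heisenberg_mul f a b) = S b *m S a,
      forall r, S (r, 0) = (lam r)%:M,
      (0 < d)%N
    & forall M : 'M[C]_d, (forall a, (M *m S a <= M)%MS) ->
      M != 0 -> row_full M].

(* The operator identity W(g) S(r,u) W(g)^-1 = S(r, g u).  Permutations compose
   from left to right in {perm V}, hence a matrix representation W of G acting
   on rows does satisfy W(g o g') = W(g) o W(g') as operators. *)
Definition weil_repr (G : {group {perm V}}) S (W : mx_representation C G d) : Prop :=
  forall g, g \in G -> forall r u,
    invmx (W g) *m S (r, u) *m W g = S (r, g u).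

(* The submodule nV for n = (c) a principal ideal of A. *)
Definition scaled_submodule (c : A) : {set V} := [set c *: v | v : V].

Definition fixed_mx S (D : {set V}) : 'M[C]_d :=
  (\bigcap_(w in D) kermx (S (0, w) - 1%:M))%MS.

Lemma fixed_mxP S (D : {set V}) m (M : 'M[C]_(m, d)) :
  reflect (forall w, w \in D -> M *m S (0, w) = M) (M <= fixed_mx S D)%MS.
Proof.
apply: (iffP sub_bigcapmxP) => fixM w Dw.
  by have /sub_kermxP/eqP := fixM w Dw; rewrite mulmxBr mulmx1 subr_eq0 => /eqP.
by apply/sub_kermxP; rewrite mulmxBr mulmx1 fixM ?subrr.
Qed.

Lemma fixed_mx_module (h : V -> V -> A) S
    (W : mx_representation C (unitary_group h) d) (c : A) :
  weil_repr S W -> mxmodule W (fixed_mx S (scaled_submodule c)).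
Proof.
move=> wW; apply/mxmoduleP => g Ug; apply/fixed_mxP => _ /imsetP[v _ ->].
have /unitaryP[gl _] := Ug.
have -> : c *: v = g (c *: (g^-1)%g v).
  have g0: g 0 = 0.
    by have := gl (-1) 0 0; rewrite scaler0 addr0 scaleN1r addNr.
  by have := gl c ((g^-1)%g v) 0; rewrite g0 !addr0 permKV => ->.
rewrite -(wW _ Ug) -!mulmxA (mulmxA (W g)) mulmxV ?mul1mx; last first.
  exact: (repr_mx_unit W Ug).
rewrite mulmxA; congr (_ *m _).
by move: (submx_refl (fixed_mx S (scaled_submodule c))) => /fixed_mxP->//;
   apply: imset_f.
Qed.

End Weil.

Section Constituents.

Variables (C : fieldType) (gT : finGroupType) (G : {group gT}).

(* The irreducible representation rho is (similar to) a composition factor. *)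
Definition irr_constituent m (rG : mx_representation C G m)
    k (rho : mx_representation C G k) : Prop :=
  mx_irreducible rho /\
  exists (P Q : 'M[C]_m) (modP : mxmodule rG P) (modQ : mxmodule rG Q),
    (P <= Q)%MS /\ mx_rsim (section_repr modP modQ) rho.

Definition irr_constituent_dim m (rG : mx_representation C G m) (k : nat) : Prop :=
  exists rho : mx_representation C G k, irr_constituent rG rho.

End Constituents.

Section Layers.

Variables (R A : finComUnitRingType) (V : finLmodType A) (C : fieldType).
Variables (h : V -> V -> A) (d : nat) (S : R * V -> 'M[C]_d).
Variable W : mx_representation C (unitary_group h) d.
Variables (pi : A) (l : nat).

Definition Bot : 'M[C]_d :=
  fixed_mx S (scaled_submodule V (pi ^+ (2 * l - 2))).

Lemma Bot_module : weil_repr S W -> mxmodule W Bot.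
Proof. exact: fixed_mx_module. Qed.

Hypothesis hW : weil_repr S W.

Definition Bot_repr := submod_repr (Bot_module hW).
Definition Top_repr := factmod_repr (Bot_module hW).
Definition dim_Top : nat := \rank (cokermx Bot).

End Layers.

Definition base_dims (q n : nat) : seq rat :=
  [:: (q%:R ^+ n + 1) / 2; (q%:R ^+ n - 1) / 2].

(* Used for k >= 2 only, where the natural-number subtractions are exact. *)
Definition layer_dim (q n k : nat) : rat :=
  (q%:R ^+ ((2 * k - 1) * n) - q%:R ^+ ((2 * k - 3) * n))
  / (2 * q%:R ^+ (k - 1)).

(* layer_dim at l, l - 1, ..., 2, followed by the base dimensions *)
Definition weil_dims (q n l : nat) : seq rat :=
  [seq layer_dim q n k | k <- rev (iota 2 (l - 1))] ++ base_dims q n.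

(* Main.v *)
(* Let T(v) = S(0,v).  The T(v) form a basis of End(X), and W(g) permutes them
   by conjugation, so the commutant of U is spanned by the sums of the T(v) over
   the U-orbits in V.  By reflections, every vector is conjugate to some
   pi^k (u0 + e z0), with e skew, where h(u0,z0) = 1.
   The averages e_i of T over pi^(2l-1-i) V are decreasing idempotents, with
   e_0 = 1 and e_1 the projection onto Bot; let E_i = e_i - e_(i+1) for i < l-1
   and E_(l-1) = e_(l-1).  Parametrizing N by a = +-(1+e)/(1-e), the operators
   E_i W(a), with a modulo 1 + pi^(2(l-i)-1), are as many as the representatives
   above, and they are independent: for i < l-1 they are orthogonal for the
   trace, and for i = l-1 this is a computation with tr W(-1) = +-1.  Hence they
   form a basis of the commutant, which is commutative, each irreducible Y lies
   in one layer E_i X, where the W(a) act by scalars on Y, and comparing traces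
   gives 2 q^(l-1-i) dim Y = dim E_i X for i < l-1, and 2 dim Y = q^n +- 1 in the
   last layer. *)
Require Import Defs.
From HB Require Import structures.
From mathcomp Require Import all_boot all_order all_algebra all_fingroup.
From mathcomp Require Import mxrepresentation.
From mathcomp Require Import ring zify.

Set Implicit Arguments.
Unset Strict Implicit.
Unset Printing Implicit Defensive.

Import GRing.Theory.
Local Open Scope ring_scope.

(** * Chain rings with involution *)

(** The same labels (i, b, w) index both families. In [orbit_rep] the boolean b is the parity of k,
    in the operator it is the sign of a, and in both the skew e counts only through w = pi^(2i) e.
    An upper bound on the number of orbits is then enough: the orbit sums span the commutant, and an
    independent family of the same size inside their span spans it too. Orthogonality for the trace
    comes from conjugating by T(v), which leaves traces unchanged but turns W(a) into a multiple of
    T(a^-1 v - v) W(a). If a - 1 has small valuation, the trace cannot distinguish e_i W(a) from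
    e_(i+1) W(a). The last layer has no e_(i+1) to subtract and tr W(-1) is nonzero, so
    orthogonality fails there; only the two signs are left, and independence reduces to q^(2n) <> 1.
    A linear character may change the sign of tr W(-1). Both dimensions (q^n +- 1)/2 occur whatever
    this sign is, because both eigenvalues of W(-1) occur in the last layer. *)

Lemma unit_add_nilpotent (R : comUnitRingType) (u x : R) k :
  u \is a GRing.unit -> x ^+ k = 0 -> u + x \is a GRing.unit.
Proof.
move=> Uu xk; pose y := - x / u.
have yk : y ^+ k = 0 by rewrite /y exprMn -mulN1r exprMn xk mulr0 mul0r.
have -> : u + x = u * (1 - y) by rewrite /y mulrBr mulr1 mulrCA divrr // mulr1 opprK.
rewrite unitrM Uu /= -unitrN opprB.
have := subrX1 y k; rewrite yk sub0r => e1.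
have : (y - 1) * \sum_(i < k) y ^+ i \is a GRing.unit by rewrite -e1 unitrN1.
by rewrite unitrM => /andP[].
Qed.

(** [dig] is a system of residue representatives fixed by [star], not assumed compatible with the
    operations of [F]. It serves for digit expansions, which give the cardinalities. *)
Record ramified_chain (F : finFieldType) (A : finComUnitRingType)
    (star : {rmorphism A -> A}) (pi : A) (l : nat) (dig : F -> A) : Prop :=
  RamifiedChain {
    chain_gt0 : (0 < l)%N;
    chain_nil : pi ^+ (2 * l - 1) = 0;
    chain_top : pi ^+ (2 * l - 2) != 0;
    chain_starK : involutive star;
    chain_star_pi : star pi = - pi;
    chain_unit2 : (2 : A) \is a GRing.unit;
    dig_star : forall c, star (dig c) = dig c;
    dig_unit : forall c c', c != c' -> dig c - dig c' \is a GRing.unit;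
    dig_ex : forall a, exists c b, a = dig c + pi * b }.

Section Chain.

Variables (F : finFieldType) (A : finComUnitRingType).
Variables (star : {rmorphism A -> A}) (pi : A) (l : nat) (dig : F -> A).
Hypothesis chainA : ramified_chain star pi l dig.

Let l_gt0 := chain_gt0 chainA.
Let pi_nil := chain_nil chainA.
Let unit2 := chain_unit2 chainA.
Let starK := chain_starK chainA.

Lemma unit_add_pi u b : u \is a GRing.unit -> u + pi * b \is a GRing.unit.
Proof. by move=> Uu; apply: (@unit_add_nilpotent _ _ _ (2 * l - 1) Uu); rewrite exprMn pi_nil mul0r. Qed.

Lemma unit_or_pi a : a \is a GRing.unit \/ exists b, a = pi * b.
Proof.
(* [dig] need not send 0 to 0, so the digit c0 of the element 0 plays the part of the zero digit. *)
have [c [b ->]] := dig_ex chainA a; have [c0 [b0 e0]] := dig_ex chainA 0.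
have [->|/(dig_unit chainA) U] := eqVneq c c0.
  by right; exists (b - b0); rewrite mulrBr -[RHS]addr0 e0; ring.
left; have -> : dig c + pi * b = (dig c - dig c0) + pi * (b - b0).
  by rewrite -[LHS]subr0 {1}e0; ring.
exact: unit_add_pi.
Qed.

Lemma pi_mul_nunit b : pi * b \isn't a GRing.unit.
Proof.
apply/negP => U; have : (pi * b) ^+ (2 * l - 1) \is a GRing.unit by rewrite unitrX.
by rewrite exprMn pi_nil mul0r unitr0.
Qed.

Lemma pi_exp_eq0 k : (2 * l - 1 <= k)%N -> pi ^+ k = 0.
Proof. by move=> le; rewrite -(subnKC le) exprD pi_nil mul0r. Qed.

Lemma pi_exp_mul_eq0 k u : u \is a GRing.unit -> pi ^+ k * u = 0 -> (2 * l - 1 <= k)%N.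
Proof.
move=> Uu /(canRL (mulrK Uu)); rewrite mul0r => pik0.
rewrite leqNgt; apply/negP => lt; have /negP := chain_top chainA; apply; apply/eqP.
have -> : (2 * l - 2 = k + (2 * l - 2 - k))%N by lia.
by rewrite exprD pik0 mul0r.
Qed.

Lemma pi_valuation a : a != 0 ->
  exists k u, [/\ (k < 2 * l - 1)%N, u \is a GRing.unit & a = pi ^+ k * u].
Proof.
move=> nz.
have H m : (exists b, a = pi ^+ m * b) \/
    exists k u, [/\ (k < 2 * l - 1)%N, u \is a GRing.unit & a = pi ^+ k * u].
  elim: m => [|m [[b e]|?]]; [by left; exists a; rewrite mul1r| |by right].
  have [U|[c ec]] := unit_or_pi b; last by left; exists c; rewrite e ec exprSr mulrA.
  right; exists m, b; split=> //; rewrite ltnNge; apply/negP => /pi_exp_eq0 z.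
  by rewrite e z mul0r eqxx in nz.
by case: (H (2 * l - 1)%N) => // -[b e]; rewrite e pi_nil mul0r eqxx in nz.
Qed.

Lemma pi_annihilator j a : (j <= 2 * l - 1)%N -> pi ^+ j * a = 0 ->
  exists b, a = pi ^+ (2 * l - 1 - j) * b.
Proof.
move=> jl; have [->|nz] := eqVneq a 0; first by exists 0; rewrite mulr0.
have [k [u [kl U ->]]] := pi_valuation nz; rewrite mulrA -exprD => /(pi_exp_mul_eq0 U) le.
by exists (pi ^+ (k - (2 * l - 1 - j)) * u); rewrite mulrA -exprD; congr (pi ^+ _ * _); lia.
Qed.

Lemma star_pi_exp k : star (pi ^+ k) = (-1) ^+ k * pi ^+ k.
Proof. by rewrite rmorphXn /= (chain_star_pi chainA) -exprMn mulN1r. Qed.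

Lemma star_mod_pi a : exists b, a - star a = pi * b.
Proof.
have [c [b ->]] := dig_ex chainA a; exists (b + star b).
by rewrite rmorphD rmorphM /= (dig_star chainA) (chain_star_pi chainA); ring.
Qed.

(** * Skew elements and digit counts *)

Definition skew : {set A} := [set e | star e == - e].

Lemma skewP e : reflect (star e = - e) (e \in skew).
Proof. by rewrite inE; apply: eqP. Qed.

Lemma skew0 : 0 \in skew.
Proof. by apply/skewP; rewrite rmorph0 oppr0. Qed.

Lemma skewB e e' : e \in skew -> e' \in skew -> e - e' \in skew.
Proof. by move=> /skewP s1 /skewP s2; apply/skewP; rewrite rmorphB /= s1 s2; ring. Qed.

Lemma skewN e : e \in skew -> - e \in skew.
Proof. by move=> /skewP s1; apply/skewP; rewrite rmorphN /= s1. Qed.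

Lemma double_half (a : A) : (a + a) / 2 = a.
Proof. by rewrite -mulr2n -[X in X / _]mulr_natr mulrK. Qed.

Lemma star_half (a : A) : star (a / 2) = star a / 2.
Proof. by rewrite rmorphM rmorphV ?rmorph_nat. Qed.

Lemma skew_pi e : e \in skew -> exists b, e = pi * b.
Proof.
move=> /skewP s1; have [b] := star_mod_pi e; rewrite s1 opprK => e2.
by exists (b / 2); rewrite mulrA -e2 double_half.
Qed.

(** For even k, skewness says pi^k (star u + u) = 0; but star u is congruent to u modulo pi, so star
    u + u is a unit like 2 u. *)
Lemma skew_odd k u : (k < 2 * l - 1)%N -> u \is a GRing.unit ->
  pi ^+ k * u \in skew -> odd k.
Proof.
move=> kl U /skewP; rewrite rmorphM /= star_pi_exp -signr_odd; case: (odd k) => //.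
rewrite mul1r => /eqP; rewrite -subr_eq0 opprK -mulrDr => /eqP.
have [b eb] := star_mod_pi u.
have -> : star u + u = 2 * u + pi * - b by rewrite mulrN -eb; ring.
by move/pi_exp_mul_eq0; rewrite unit_add_pi ?unitrM ?unit2 //; lia.
Qed.

Definition pi_layer m : {set A} := [set pi ^+ m * a | a in A].

(* As [skew] consists of the odd elements of [A], this is [R pi^(2 i + 1)]. *)
Definition odd_layer i : {set A} := [set pi ^+ (2 * i) * e | e in skew].

(* Digit expansions: [L] has one element [pi^k * dig c + y] for each digit [c]
   and each [y] in [L']. *)
Lemma card_digit_extension (L L' : {set A}) k : (k < 2 * l - 1)%N ->
    (forall y, y \in L' -> exists b, y = pi ^+ k.+1 * b) ->
    (forall x, reflect (exists c y, y \in L' /\ x = pi ^+ k * dig c + y) (x \in L)) ->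
  #|L| = (#|F| * #|L'|)%N.
Proof.
move=> kl L'pi LP.
have -> : L = [set pi ^+ k * dig cy.1 + cy.2 | cy in setX [set: F] L'].
  apply/setP => x; apply/LP/imsetP => [[c [y [Ly ->]]]|[[c y]]].
    by exists (c, y); rewrite ?inE.
  by rewrite inE /= => /andP[_ Ly] ->; exists c, y.
rewrite card_in_imset ?cardsX ?cardsT // => -[c y] [c' y'].
rewrite !inE /= => L1 L2 e.
have ec : c = c'.
  apply/eqP/negPn/negP => /(dig_unit chainA) U.
  have [b1 e1] := L'pi _ L1; have [b2 e2] := L'pi _ L2.
  have : pi ^+ k * ((dig c - dig c') + pi * (b1 - b2)) = 0.
    transitivity ((pi ^+ k * dig c + y) - (pi ^+ k * dig c' + y')).
      by rewrite e1 e2 !exprSr; ring.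
    by rewrite e subrr.
  by move/pi_exp_mul_eq0; rewrite unit_add_pi //; lia.
by move: e; rewrite ec => /addrI ->.
Qed.

Lemma card_pi_layer m : (m <= 2 * l - 1)%N -> #|pi_layer m| = (#|F| ^ (2 * l - 1 - m))%N.
Proof.
move=> ml; rewrite -{1}(subKn ml); move: (_ - m)%N (leq_subr m (2 * l - 1)) => {ml m} m.
elim: m => [_|m IH ml].
  rewrite subn0 expn0; apply/eqP/cards1P; exists 0; apply/setP => x; rewrite inE.
  apply/imsetP/eqP => [[a _ ->]|->]; first by rewrite pi_nil mul0r.
  by exists 0; rewrite ?mulr0.
rewrite expnS -IH; last by lia.
apply: (@card_digit_extension _ _ (2 * l - 1 - m.+1)); first by lia.
  move=> y /imsetP[a _ ->]; exists a; congr (pi ^+ _ * _); lia.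
have eS : (2 * l - 1 - m = (2 * l - 1 - m.+1).+1)%N by lia.
move=> x; apply: (iffP imsetP) => [[a _ ->]|[c [y [/imsetP[a _ ->] ->]]]].
  have [c [b ->]] := dig_ex chainA a.
  exists c, (pi ^+ (2 * l - 1 - m) * b); split; first by apply: imset_f.
  by rewrite eS exprSr; ring.
by exists (dig c + pi * a) => //; rewrite eS exprSr; ring.
Qed.

(** As pi is a zero divisor, the b in e = pi b need not be fixed by [star]. Only pi b matters, so b
    is replaced by its symmetric part r. After the first digit of r is removed, the cofactor b' is
    in the same way replaced by its skew part. *)
Lemma skew_expansion e : e \in skew ->
  exists c e', e' \in skew /\ e = pi * dig c + pi ^+ 2 * e'.
Proof.
move=> se; have [b eb] := skew_pi se.
have {}eb : e = pi * ((b + star b) / 2).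
  have: star (pi * b) = - (pi * b) by rewrite -eb; apply/skewP.
  rewrite rmorphM /= (chain_star_pi chainA) mulNr => /oppr_inj h.
  by rewrite mulrA mulrDr h -eb double_half.
have sr : star ((b + star b) / 2) = (b + star b) / 2.
  by rewrite star_half rmorphD /= starK addrC.
move: (_ / 2) eb sr => r er sr.
have [c [b' eb']] := dig_ex chainA r.
exists c, ((b' - star b') / 2); split.
  by apply/skewP; rewrite star_half rmorphB /= starK -mulNr opprB.
have h : pi * star b' = - (pi * b').
  move: sr; rewrite eb' rmorphD rmorphM /= (dig_star chainA) (chain_star_pi chainA).
  by move/addrI; rewrite mulNr => <-; rewrite opprK.
rewrite er eb' mulrDr; congr (_ + _).
rewrite expr2 -!mulrA; congr (_ * _); rewrite mulrA mulrBr h opprK.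
by rewrite double_half.
Qed.

(** Two powers of pi cost a single digit, because only odd powers of pi carry digits of a skew
    element. *)
Lemma card_odd_layer i : (i < l)%N -> #|odd_layer i| = (#|F| ^ (l - 1 - i))%N.
Proof.
move=> il; have {il} : (i <= l - 1)%N by lia.
move=> il; rewrite -{1}(subKn il); move: (_ - i)%N (leq_subr i (l - 1)) => {il i} m.
elim: m => [_|m IH ml].
  rewrite subn0 expn0; apply/eqP/cards1P; exists 0; apply/setP => x; rewrite inE.
  apply/imsetP/eqP => [[a /skew_pi[b ->] ->]|->].
    by rewrite mulrA -exprSr (_ : (2 * (l - 1)).+1 = (2 * l - 1)%N) ?pi_nil ?mul0r //; lia.
  by exists 0; rewrite ?mulr0 ?skew0.
rewrite expnS -IH; last by lia.
have eS : (2 * (l - 1 - m) = (2 * (l - 1 - m.+1)).+2)%N by lia.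
apply: (@card_digit_extension _ _ (2 * (l - 1 - m.+1)).+1); first by lia.
  by move=> y /imsetP[a _ ->]; exists a; rewrite eS.
move=> x; apply: (iffP imsetP) => [[e se ->]|[c [y [/imsetP[e se ->] ->]]]].
  have [c [e' [se' ->]]] := skew_expansion se.
  exists c, (pi ^+ (2 * (l - 1 - m)) * e'); split; first by apply: imset_f.
  by rewrite eS !exprSr; ring.
exists (pi * dig c + pi ^+ 2 * e); last by rewrite eS !exprSr; ring.
apply/skewP; rewrite rmorphD !rmorphM /= (chain_star_pi chainA) (dig_star chainA).
rewrite (skewP _ se); ring.
Qed.

(** * The norm-one group *)

Definition cayley (b : bool) (e : A) : A := (-1) ^+ b * ((1 + e) / (1 - e)).

Lemma skew_unit1B e : e \in skew -> 1 - e \is a GRing.unit.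
Proof. by case/skew_pi=> b ->; rewrite -mulrN unit_add_pi ?unitr1. Qed.

Lemma skew_unit1D e : e \in skew -> 1 + e \is a GRing.unit.
Proof. by move=> /skewN/skew_unit1B; rewrite opprK. Qed.

Lemma cayley_norm_one b e : e \in skew -> cayley b e \in norm_one star.
Proof.
move=> se; have U := skew_unit1B se; have U' := skew_unit1D se.
rewrite inE unitrM unitrX ?unitrN1 // unitrM U' unitrV U /=; apply/eqP.
rewrite !rmorphM rmorphXn rmorphN1 rmorphV //= rmorphB rmorphD !rmorph1 (skewP _ se) opprK.
by rewrite mulrACA -expr2 sqrr_sign mul1r mulrACA -invrM // divrr // unitrM U U'.
Qed.

Lemma cayleyE b e : e \in skew -> cayley b e * (1 - e) = (-1) ^+ b * (1 + e).
Proof. by move=> se; rewrite /cayley -!mulrA mulVr ?mulr1 ?skew_unit1B. Qed.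

Lemma cayley_unit b e : e \in skew -> cayley b e \is a GRing.unit.
Proof. by move=> /(cayley_norm_one b); rewrite inE => /andP[]. Qed.

(** Clearing denominators, (1 + e)(1 - e') - (1 + e')(1 - e) = 2 (e - e'), so valuations pass from e
    - e' to the ratio minus 1. *)
Lemma cayley_ratio b e e' k u : e \in skew -> e' \in skew -> u \is a GRing.unit ->
  e - e' = pi ^+ k * u ->
  exists2 u', u' \is a GRing.unit & cayley b e / cayley b e' - 1 = pi ^+ k * u'.
Proof.
move=> se se' Uu ee.
have U := skew_unit1B se; have V := skew_unit1B se'; have Ux := cayley_unit b se'.
have Ud : cayley b e' * ((1 - e) * (1 - e')) \is a GRing.unit.
  by rewrite (unitrM (cayley _ _)) Ux unitrM U V.
exists ((-1) ^+ b * 2 * u / (cayley b e' * ((1 - e) * (1 - e')))).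
  by rewrite unitrM unitrV Ud !unitrM Uu unit2 unitrX ?unitrN1.
apply: (mulIr Ud); rewrite -[RHS]mulrA divrK // mulrA mulrBl divrK // mul1r.
have -> : pi ^+ k * ((-1) ^+ b * 2 * u) = (-1) ^+ b * 2 * (e - e') by rewrite ee; ring.
transitivity (cayley b e * (1 - e) * (1 - e') - cayley b e' * (1 - e') * (1 - e)).
  by ring.
by rewrite !cayleyE //; ring.
Qed.

(** With opposite signs the numerator becomes +-2 (1 - e e'), a unit since e lies in the radical. *)
Lemma cayley_ratio_neg b b' e e' : e \in skew -> e' \in skew -> b != b' ->
  cayley b e / cayley b' e' - 1 \is a GRing.unit.
Proof.
move=> se se' bb.
have U := skew_unit1B se; have V := skew_unit1B se'; have Ux := cayley_unit b' se'.
have [d ed] := skew_pi se; have [d' ed'] := skew_pi se'.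
suff: (cayley b e / cayley b' e' - 1) * (cayley b' e' * ((1 - e) * (1 - e'))) \is a GRing.unit.
  by rewrite unitrM => /andP[].
rewrite mulrA mulrBl divrK // mul1r.
have -> : (cayley b e - cayley b' e') * ((1 - e) * (1 - e')) = (-1) ^+ b * 2 * (1 - e * e').
  transitivity (cayley b e * (1 - e) * (1 - e') - cayley b' e' * (1 - e') * (1 - e)).
    by ring.
  by rewrite !cayleyE //; case: b b' bb {Ux} => [] [] //= _; ring.
rewrite !unitrM unitrX ?unitrN1 // unit2 ed -mulrA -mulrN unit_add_pi //.
exact: unitr1.
Qed.

Lemma cayley_inj b b' e e' : e \in skew -> e' \in skew ->
  cayley b e = cayley b' e' -> b = b' /\ e = e'.
Proof.
move=> se se' ec.
have bb : b = b'.
  apply/eqP/negPn/negP => /(cayley_ratio_neg se se').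
  by rewrite ec divrr ?cayley_unit // subrr unitr0.
split=> //; apply/eqP; rewrite -subr_eq0; apply/negPn/negP => nz.
have [k [u [kl Uu eu]]] := pi_valuation nz.
have [u' Uu'] := cayley_ratio b se se' Uu eu.
move: ec; rewrite -bb => <-; rewrite divrr ?cayley_unit // subrr => /esym/(pi_exp_mul_eq0 Uu').
by rewrite leqNgt kl.
Qed.

(** If a + 1 is a unit, e = (a - 1) / (a + 1) inverts the transform. Otherwise a is congruent to -1,
    and -a + 1 is a unit; this is what the sign b is for. *)
Lemma norm_one_cayley a : a \in norm_one star ->
  exists b e, e \in skew /\ a = cayley b e.
Proof.
rewrite inE => /andP[Ua /eqP aa].
wlog U1 : a Ua aa / a + 1 \is a GRing.unit.
  move=> W; have [U|[b1 e1]] := unit_or_pi (a + 1); first exact: W.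
  have [|||b [e [se ee]]] := W (- a); rewrite ?unitrN //.
  - by rewrite rmorphN mulrNN.
  - have -> : - a + 1 = 2 + pi * - b1 by rewrite mulrN -e1; ring.
    exact: unit_add_pi.
  exists (~~ b), e; split=> //; rewrite -[LHS]opprK ee /cayley.
  by case: b {ee}; rewrite /= ?expr1 ?expr0; ring.
have sU : star a + 1 \is a GRing.unit by rewrite -(rmorph1 star) -rmorphD rmorph_unit.
have e1 : (star a + 1) * a = a + 1 by rewrite mulrDl mulrC aa; ring.
exists false, ((a - 1) / (a + 1)).
have se : (a - 1) / (a + 1) \in skew.
  apply/skewP; apply: (mulIr sU); apply: (mulIr Ua).
  rewrite rmorphM rmorphV //= rmorphB rmorphD !rmorph1 divrK // -[RHS]mulrA e1.
  by rewrite mulNr divrK // mulrBl mulrC aa; ring.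
split=> //; apply: (mulIr (skew_unit1B se)); rewrite cayleyE // expr0 mul1r.
apply: (mulIr U1); have := divrK U1 (a - 1); move: (_ / _) => y ey.
transitivity (a * (a + 1 - y * (a + 1))); first by ring.
transitivity (a + 1 + y * (a + 1)); last by ring.
by rewrite ey; ring.
Qed.

Lemma card_norm_one : #|norm_one star| = (2 * #|F| ^ (l - 1))%N.
Proof.
have -> : norm_one star = [set cayley be.1 be.2 | be in setX [set: bool] skew].
  apply/setP => a; apply/idP/imsetP => [/norm_one_cayley[b [e [se ->]]]|].
    by exists (b, e); rewrite ?inE // in se *.
  by case=> -[b e]; rewrite in_setX /= => /andP[_ se] ->; apply: cayley_norm_one.
rewrite card_in_imset => [|[b e] [b' e']]; last first.
  by rewrite !in_setX /= => /andP[_ s1] /andP[_ s2] /(cayley_inj s1 s2)[-> ->].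
rewrite cardsX cardsT card_bool; congr (_ * _)%N.
have /= := card_odd_layer l_gt0; rewrite subn0 => <-.
by rewrite /odd_layer muln0 card_imset // => x y; rewrite !mul1r.
Qed.

End Chain.

(** * Orbits of the unitary group *)

Section Unitary.

Variables (F : finFieldType) (A : finComUnitRingType).
Variables (star : {rmorphism A -> A}) (pi : A) (l : nat) (dig : F -> A).
Hypothesis chainA : ramified_chain star pi l dig.
Variables (V : finLmodType A) (m : nat).
Hypothesis freeV : free_of_rank V m.
Hypothesis m_gt0 : (0 < m)%N.
Variable h : V -> V -> A.
Hypothesis hP : nondegenerate_skew_hermitian star h.

Lemma hermDr u v w : h u (v + w) = h u v + h u w.
Proof. by have [H _ _ _] := hP; have := H u 1 v w; rewrite scale1r mul1r. Qed.

Lemma herm0r u : h u 0 = 0.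
Proof. by have := hermDr u 0 0; rewrite addr0 => /(congr1 (+%R^~ (- h u 0))); rewrite addrK subrr. Qed.

Lemma hermZr u a v : h u (a *: v) = a * h u v.
Proof. by have [H _ _ _] := hP; have := H u a v 0; rewrite !addr0 herm0r addr0. Qed.

Lemma hermC u v : h v u = - star (h u v).
Proof. by have [_ _ H _] := hP. Qed.

Lemma hermDl u v w : h (u + v) w = h u w + h v w.
Proof. by rewrite hermC hermDr rmorphD opprD -!hermC. Qed.

Lemma hermZl a u w : h (a *: u) w = star a * h u w.
Proof. by rewrite hermC hermZr rmorphM -mulrN -hermC. Qed.

Lemma herm0l u : h 0 u = 0.
Proof. by rewrite hermC herm0r rmorph0 oppr0. Qed.

Lemma hermNr u v : h u (- v) = - h u v.
Proof. by rewrite -scaleN1r hermZr mulN1r. Qed.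

Lemma hermNl u v : h (- u) v = - h u v.
Proof. by rewrite -scaleN1r hermZl rmorphN1 mulN1r. Qed.

Lemma herm_skew u : h u u \in skew star.
Proof. by apply/skewP; rewrite {2}hermC opprK. Qed.

Lemma herm_nondeg u : (forall v, h u v = 0) -> u = 0.
Proof. by move=> H; have [_ _ _ I] := hP; apply: I => v; rewrite H herm0l. Qed.

Lemma free_annihilator j (v : V) : (j <= 2 * l - 1)%N -> pi ^+ j *: v = 0 ->
  exists w, v = pi ^+ (2 * l - 1 - j) *: w.
Proof.
move=> jl; have [e be] := freeV; have [g ge eg] := be.
rewrite -(eg v); move: (g v) => c; rewrite scaler_sumr => e0.
have c0 i : exists b, c i == pi ^+ (2 * l - 1 - j) * b.
  have : [ffun i => pi ^+ j * c i] = [ffun => 0] :> {ffun 'I_m -> A}.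
    apply: (bij_inj be); rewrite /= [RHS]big1 => [|k _]; last by rewrite ffunE scale0r.
    by rewrite -[RHS]e0; apply: eq_bigr => k _; rewrite ffunE scalerA.
  by move/ffunP/(_ i); rewrite !ffunE => /(pi_annihilator chainA jl)[b ->]; exists b.
exists (\sum_i xchoose (c0 i) *: e i); rewrite scaler_sumr; apply: eq_bigr => i _.
by rewrite scalerA -(eqP (xchooseP (c0 i))).
Qed.

Lemma card_scaled_layer k : (k <= 2 * l - 1)%N ->
  #|scaled_submodule V (pi ^+ k)| = ((#|F| ^ (2 * l - 1 - k)) ^ m)%N.
Proof.
move=> kl; have [e be] := freeV; have [g ge eg] := be.
have -> : scaled_submodule V (pi ^+ k) =
    [set \sum_i c i *: e i | c : {ffun 'I_m -> A} in ffun_on (mem (pi_layer pi k))].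
  apply/setP => v; apply/imsetP/imsetP => [[w _ ->]|[c /ffun_onP cP ->]].
    exists [ffun i => pi ^+ k * g w i].
      by apply/ffun_onP => i; rewrite ffunE; apply: imset_f.
    by rewrite -{1}(eg w) scaler_sumr; apply: eq_bigr => i _; rewrite ffunE scalerA.
  have cb i : exists b, c i == pi ^+ k * b.
    by have /imsetP[b _ ->] := cP i; exists b.
  exists (\sum_i xchoose (cb i) *: e i) => //.
  by rewrite scaler_sumr; apply: eq_bigr => i _; rewrite scalerA -(eqP (xchooseP (cb i))).
rewrite card_imset; last exact: bij_inj be.
by rewrite card_ffun_on card_ord (card_pi_layer chainA).
Qed.

Lemma card_free : #|V| = ((#|F| ^ (2 * l - 1)) ^ m)%N.
Proof.
rewrite -[in RHS](subn0 (2 * l - 1)%N) -card_scaled_layer // -cardsT.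
apply: eq_card => v; rewrite !inE; apply/esym/imsetP; exists v => //.
by rewrite scale1r.
Qed.

(** * Primitive vectors and transitivity *)

Definition primitive (v : V) := [forall w, v != pi *: w].

Lemma primitiveP v : reflect (forall w, v <> pi *: w) (primitive v).
Proof. by apply: (iffP forallP) => H w; apply/eqP; apply: H. Qed.

Lemma vector_valuation (v : V) : v != 0 ->
  exists k w, [/\ (k < 2 * l - 1)%N, primitive w & v = pi ^+ k *: w].
Proof.
move=> nz.
have H k : (exists w, v = pi ^+ k *: w) \/
    exists k' w, [/\ (k' < 2 * l - 1)%N, primitive w & v = pi ^+ k' *: w].
  elim: k => [|k [[w e]|?]]; [by left; exists v; rewrite scale1r| |by right].
  have [pw|/forallPn[w' /negPn/eqP ew]] := boolP (primitive w); last first.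
    by left; exists w'; rewrite e ew exprSr scalerA.
  right; exists k, w; split=> //; rewrite ltnNge; apply/negP => /(pi_exp_eq0 chainA) z.
  by rewrite e z scale0r eqxx in nz.
by case: (H (2 * l - 1)%N) => // -[w e]; rewrite e (chain_nil chainA) scale0r eqxx in nz.
Qed.

(** Without primitive vectors the valuation leaves only the vector 0, against the cardinality of
    V. *)
Lemma exists_primitive : exists v, primitive v.
Proof.
have [/existsP//|/existsPn H] := boolP [exists v, primitive v].
have card1 : (#|V| <= 1)%N.
  apply/card_le1P => u _ v; rewrite [RHS]inE; have [//|] := eqVneq v u.
  wlog v0 : v u / u = 0.
    move=> W; have [->|nu _] := eqVneq u 0; first exact: W.
    by have [k [w [_]]] := vector_valuation nu; rewrite (negPf (H w)).
  by rewrite v0 => /vector_valuation[k [w [_]]]; rewrite (negPf (H w)).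
move: card1; rewrite card_free -expnM leqNgt -[1%N](expn0 #|F|) ltn_exp2l; last exact: card_finNzRing_gt1.
by rewrite muln_gt0 m_gt0; have := chain_gt0 chainA; lia.
Qed.

(** If no h v w were a unit, pi^(2l-2) v would be orthogonal to all of V, hence 0, and v would be a
    multiple of pi. *)
Lemma primitive_pair v : primitive v -> exists w, h v w = 1.
Proof.
move=> /primitiveP pv.
have [/existsP[w U]|/existsPn H] := boolP [exists w, h v w \is a GRing.unit].
  by exists ((h v w)^-1 *: w); rewrite hermZr mulVr.
have := chain_gt0 chainA => l0; have pv0 : pi ^+ (2 * l - 2) *: v = 0.
  apply: herm_nondeg => w; rewrite hermZl (star_pi_exp chainA) -mulrA.
  have [U|[b ->]] := unit_or_pi chainA (h v w); first by have := H w; rewrite U.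
  rewrite (mulrA (pi ^+ _)) -exprSr (_ : (2 * l - 2).+1 = 2 * l - 1)%N; last by lia.
  by rewrite (chain_nil chainA) mul0r mulr0.
have [|w ew] := free_annihilator _ pv0; first by lia.
by case: (pv w); rewrite ew; congr (_ *: _); rewrite (_ : 2 * l - 1 - _ = 1)%N //; lia.
Qed.

(* The norm of [u + e z], with [h u z = 1], is [h u u + 2 e - e^2 h z z]; it
   differs from a translation of [2 e] by terms in the radical, hence is an
   injective function of the skew element [e]. *)
Lemma norm_attained u z c : h u z = 1 -> c \in skew star ->
  exists2 e, e \in skew star & h (u + e *: z) (u + e *: z) = c.
Proof.
move=> uz sc; pose N e := h (u + e *: z) (u + e *: z).
have NE e : e \in skew star -> N e = h u u + 2 * e - e * e * h z z.
  move=> /skewP se; rewrite /N !hermDl !hermDr !hermZl !hermZr uz (hermC u z) uz se rmorph1.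
  by ring.
have injN : {in skew star &, injective N}.
  move=> e e' s1 s2; rewrite !NE // => eN; apply/eqP; rewrite -subr_eq0; apply/eqP.
  have [b eb] := skew_pi chainA s1; have [b' eb'] := skew_pi chainA s2.
  have U : 2 - (e + e') * h z z \is a GRing.unit.
    have -> : 2 - (e + e') * h z z = 2 + pi * - ((b + b') * h z z) by rewrite eb eb'; ring.
    exact: (unit_add_pi chainA) (chain_unit2 chainA).
  apply: (mulIr U); rewrite mul0r -(subrr (h u u + 2 * e' - e' * e' * h z z)) -{1}eN.
  by ring.
(* An injective map of a finite set into itself is onto. *)
have sub : N @: skew star \subset skew star.
  by apply/subsetP => _ /imsetP[e _ ->]; apply: herm_skew.
have eqN : N @: skew star = skew star.
  by apply/eqP; rewrite eqEcard sub (card_in_imset injN) leqnn.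
by move: sc; rewrite -{1}eqN => /imsetP[e se ->]; exists e.
Qed.

Lemma herm_preserving_unitary (g : V -> V) :
    (forall a u v, g (a *: u + v) = a *: g u + g v) ->
    (forall u v, h (g u) (g v) = h u v) ->
  exists2 x, x \in unitary_group h & x =1 g.
Proof.
move=> gl gh.
have injg : injective g.
  move=> u v e; apply/eqP; rewrite -subr_eq0; apply/eqP/herm_nondeg => w.
  by rewrite hermDl hermNl -gh e gh subrr.
exists (perm injg); last exact: permE.
by apply/unitaryP; split=> *; rewrite !permE.
Qed.

Definition unitary_conj v w := exists2 g, g \in unitary_group h & g v = w.

Lemma unitary_conj_sym v w : unitary_conj v w -> unitary_conj w v.
Proof. by case=> g Ug <-; exists (g^-1)%g; rewrite ?groupV // permK. Qed.

Lemma unitary_conj_trans u v w : unitary_conj u v -> unitary_conj v w -> unitary_conj u w.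
Proof. by case=> g Ug <- [k Uk <-]; exists (g * k)%g; rewrite ?groupM // permM. Qed.

(* The map [x |-> x + (h u w)^-1 * h u x *: u] with [u = v - w] is unitary and
   sends [w] to [v]. *)
Lemma reflection_conj v w : h v v = h w w -> h v w \is a GRing.unit -> unitary_conj w v.
Proof.
move=> vw U; pose u := v - w.
have Ux : h u w \is a GRing.unit.
  have [b eb] := skew_pi chainA (herm_skew w).
  by rewrite hermDl hermNl eb -mulrN; apply: (unit_add_pi chainA).
pose c := (h u w)^-1; pose g x := x + (c * h u x) *: u.
(* This is the condition for g to preserve h. Divided by c * star c it reads h u w + h w u + h u u =
   0, which is h v v = h w w expanded. *)
have cE : star c - c + c * star c * h u u = 0.
  have Usx : star (h u w) \is a GRing.unit by rewrite rmorph_unit.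
  have e1 : h u w - star (h u w) + h u u = 0.
    rewrite -hermC /u !hermDl !hermNl !hermDr !hermNr vw; ring.
  rewrite -[RHS](mul0r (c * star c)) -e1 /c rmorphV //.
  transitivity (star c * (h u w * c) - c * (star (h u w) * star c) + c * star c * h u u); last first.
    by rewrite /c rmorphV //; ring.
  by rewrite /c rmorphV // !mulrV // !mulr1.
have gl a x y : g (a *: x + y) = a *: g x + g y.
  rewrite /g; move: (c) (u) => c' u'; rewrite hermDr hermZr mulrDr scalerDl scalerDr scalerA mulrCA -!addrA; congr (_ + _).
  by rewrite addrCA.
have gh x y : h (g x) (g y) = h x y.
  rewrite /g; move: (u) (c) cE => u' c' cE'; rewrite !hermDl !hermDr !hermZl !hermZr rmorphM (hermC u' x).
  transitivity (h x y + star (h u' x) * h u' y * (star c' - c' + c' * star c' * h u' u')); first by ring.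
  by rewrite cE' mulr0 addr0.
have [x Ux' ex] := herm_preserving_unitary gl gh; exists x => //.
by rewrite ex /g /c mulVr // scale1r /u addrC subrK.
Qed.

Lemma primitive_unit v : primitive v -> exists y, h y v \is a GRing.unit.
Proof.
by move=> /primitive_pair[w e]; exists w; rewrite hermC e rmorph1 unitrN1.
Qed.

Lemma unit_plus_nunit (a b : A) :
  a \is a GRing.unit -> b \isn't a GRing.unit -> a + b \is a GRing.unit.
Proof.
by move=> U; have [->//|[c ->] _] := unit_or_pi chainA b; apply: (unit_add_pi chainA).
Qed.

(** A reflection needs h v w to be a unit, so an intermediate vector pairing to units with both v
    and w is used. Such a y is y1, y2 or y1 + y2; adding e z gives it the right norm and changes its
    pairings only by radical elements. *)
Lemma primitive_conj v w : primitive v -> primitive w -> h v v = h w w -> unitary_conj v w.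
Proof.
move=> pv pw evw.
have [y Uyv Uyw] : exists2 y, h y v \is a GRing.unit & h y w \is a GRing.unit.
  have [y1 U1] := primitive_unit pv; have [y2 U2] := primitive_unit pw.
  have [U3|N3] := boolP (h y1 w \is a GRing.unit); first by exists y1.
  have [U4|N4] := boolP (h y2 v \is a GRing.unit); first by exists y2.
  exists (y1 + y2); rewrite hermDl; first exact: unit_plus_nunit.
  by rewrite addrC; apply: unit_plus_nunit.
have [z ez] : exists z, h y z = 1.
  by exists ((h y v)^-1 *: v); rewrite hermZr mulVr.
have [e se en] := norm_attained ez (herm_skew v).
have yU x : h y x \is a GRing.unit -> h (y + e *: z) x \is a GRing.unit.
  have [b eb] := skew_pi chainA (skewN se).
  by rewrite hermDl hermZl (skewP _ _ se) eb -mulrA; apply: (unit_add_pi chainA).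
apply: (unitary_conj_trans (v := y + e *: z)).
  by apply: reflection_conj; rewrite ?yU.
by apply: unitary_conj_sym; apply: reflection_conj; rewrite ?yU // en.
Qed.

(* The vectors [pi^k (u0 + e z0)] with [k = 2 i + b] and [e] skew represent all
   orbits; only [w = pi^(2 i) e] matters, which is what makes the number of
   representatives right. *)
Definition orbit_rep (u0 z0 : V) (i : nat) (b : bool) (w : A) : V :=
  pi ^+ b *: (pi ^+ (2 * i) *: u0 + w *: z0).

Lemma orbit_rep_surj u0 z0 v : h u0 z0 = 1 ->
  exists i b w, [/\ (i < l)%N, w \in odd_layer star pi i
                  & unitary_conj v (orbit_rep u0 z0 i b w)].
Proof.
move=> uz; have l0 := chain_gt0 chainA.
have [k [e [lek se ce]]] : exists k e, [/\ (k <= 2 * l - 1)%N, e \in skew star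
    & unitary_conj v (pi ^+ k *: (u0 + e *: z0))].
  (* The zero vector takes k = 2l-1, that is i = l-1 and b = true, which is why k may reach 2l-1. *)
  have [->|/vector_valuation[k [w [kl pw ->]]]] := eqVneq v 0.
    exists (2 * l - 1)%N, 0; split=> //; first exact: skew0.
    by exists 1%g; rewrite ?group1 // perm1 (chain_nil chainA) scale0r.
  (* The representative is given the norm of w, so that [primitive_conj] applies. *)
  have [e se en] := norm_attained uz (herm_skew w).
  have pe : primitive (u0 + e *: z0).
    apply/primitiveP => x ex; have : h (u0 + e *: z0) z0 \is a GRing.unit.
      have [b eb] := skew_pi chainA (skewN se).
      rewrite hermDl hermZl (skewP _ _ se) uz eb -mulrA; apply: (unit_add_pi chainA).
      exact: unitr1.
    rewrite ex hermZl (chain_star_pi chainA) mulNr -mulrN; apply/negP.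
    exact: pi_mul_nunit chainA _.
  exists k, e; split=> //; first exact: ltnW.
  have [g Ug eg] := primitive_conj pw pe (esym en); exists g => //.
  by have /unitaryP[gl _] := Ug; rewrite -eg -[in LHS](addr0 (_ *: w)) gl -[RHS]addr0; congr (_ + _);
     have := gl (-1) 0 0; rewrite scaler0 addr0 scaleN1r addNr.
exists k./2, (odd k), (pi ^+ (2 * k./2) * e); split; first by lia.
  by apply: imset_f.
suff -> : orbit_rep u0 z0 k./2 (odd k) (pi ^+ (2 * k./2) * e) = pi ^+ k *: (u0 + e *: z0) by [].
by rewrite /orbit_rep -scalerA -scalerDr scalerA -exprD mul2n odd_double_half.
Qed.

(* The default value 1 of [insubd] is taken only when [a] is not a unit. *)
Definition scalar_perm (a : A) : {perm V} :=
  insubd (1%g : {perm V}) [ffun x : V => a *: x].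

Lemma scalar_permE a x : a \is a GRing.unit -> scalar_perm a x = a *: x.
Proof.
move=> Ua; rewrite -pvalE -[pval _]/(val _) /scalar_perm val_insubd.
have -> : injectiveb [ffun x : V => a *: x].
  by apply/injectiveP => u v; rewrite !ffunE => /(congr1 ( *:%R a^-1)); rewrite !scalerA mulVr // !scale1r.
by rewrite ffunE.
Qed.

Lemma scalar_permM a b : a \is a GRing.unit -> b \is a GRing.unit ->
  scalar_perm (a * b) = (scalar_perm a * scalar_perm b)%g.
Proof.
move=> Ua Ub; apply/permP => x.
by rewrite permM !scalar_permE ?unitrM ?Ua // scalerA mulrC.
Qed.

Lemma scalar_perm_unitary a : a \in norm_one star -> scalar_perm a \in unitary_group h.
Proof.
rewrite inE => /andP[Ua /eqP aa]; apply/unitaryP; split=> *; rewrite !scalar_permE //.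
  by rewrite scalerDr !scalerA mulrC.
by rewrite hermZl hermZr mulrA (mulrC (star a)) aa mul1r.
Qed.

End Unitary.

(** * Operators on the Schroedinger representation *)

Section LinearSpan.

Variables (K : fieldType) (I : finType) (d : nat).
Implicit Types (z o : I -> 'M[K]_d).

Lemma sum_family_submx z M :
  (exists x : I -> K, M = \sum_i x i *: z i) <->
  (mxvec M <= \matrix_(k < #|I|) mxvec (z (enum_val k)))%MS.
Proof.
have sumE x : mxvec (\sum_i x i *: z i) =
    (\row_k x (enum_val k)) *m \matrix_(k < #|I|) mxvec (z (enum_val k)).
  rewrite mulmx_sum_row linear_sum (reindex (@enum_val I I)) /=; last first.
    by apply: onW_bij; apply: enum_val_bij.
  by apply: eq_bigr => k _; rewrite linearZ rowK mxE.
split=> [[x ->]|/submxP[y ey]]; first by rewrite sumE submxMl.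
exists (fun i => y 0 (enum_rank i)); apply: (can_inj mxvecK); rewrite sumE ey.
by congr (_ *m _); apply/rowP => k; rewrite mxE enum_valK.
Qed.

(** Both families have the index type [I]: the z i span a space of dimension #|I| inside the span of
    the o j, which has dimension at most #|I|. *)
Lemma independent_family_spans z o M :
    (forall i, exists x : I -> K, z i = \sum_j x j *: o j) ->
    (forall x : I -> K, \sum_i x i *: z i = 0 -> forall i, x i = 0) ->
    (exists x : I -> K, M = \sum_j x j *: o j) ->
  exists x : I -> K, M = \sum_j x j *: z j.
Proof.
move=> zo indep /sum_family_submx Mo; apply/sum_family_submx.
set Z := (X in (_ <= X)%MS); move: Mo; set O := (X in (_ <= X)%MS) => Mo.
have ZO : (Z <= O)%MS.
  by apply/row_subP => k; rewrite rowK; apply/sum_family_submx/zo.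
have Zfree : row_free Z.
  rewrite -kermx_eq0; apply/rowV0P => y /sub_kermxP yZ.
  have e0 : \sum_i y 0 (enum_rank i) *: z i = 0.
    apply: (can_inj mxvecK); rewrite linear0 -yZ mulmx_sum_row linear_sum.
    rewrite (reindex (@enum_val I I)) /=; last by apply: onW_bij; apply: enum_val_bij.
    by apply: eq_bigr => k _; rewrite linearZ rowK enum_valK.
  by apply/rowP => k; have := indep _ e0 (enum_val k); rewrite enum_valK mxE.
apply: submx_trans Mo _; rewrite -(geq_leqif (mxrank_leqif_sup ZO)).
by rewrite (eqP Zfree) rank_leq_row.
Qed.

End LinearSpan.

Section Weyl.

Variables (C : numClosedFieldType) (V : finZmodType) (d : nat).
Variables (T : V -> 'M[C]_d) (beta : V -> V -> C).
Hypothesis d_gt0 : (0 < d)%N.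
Hypothesis T0 : T 0 = 1%:M.
Hypothesis TD : forall u v, T v *m T u = beta u v *: T (u + v).
Hypothesis betaDl : forall u v w, beta (u + v) w = beta u w * beta v w.
Hypothesis betaC : forall u v, beta u v * beta v u = 1.
Hypothesis betaxx : forall v, beta v v = 1.
Hypothesis beta_nondeg : forall v, v != 0 -> exists u, beta u v ^+ 2 != 1.
Hypothesis T_irr :
  forall M : 'M[C]_d, (forall v, (M *m T v <= M)%MS) -> M != 0 -> row_full M.

Lemma beta_neq0 u v : beta u v != 0.
Proof. by apply/negP => /eqP e; have := betaC u v; rewrite e mul0r => /esym/eqP; rewrite oner_eq0. Qed.

Lemma betaV u v : (beta u v)^-1 = beta v u.
Proof. by apply: (mulfI (beta_neq0 u v)); rewrite divff ?beta_neq0 // betaC. Qed.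

Lemma beta0l v : beta 0 v = 1.
Proof. by apply: (mulfI (beta_neq0 0 v)); rewrite -betaDl addr0 mulr1. Qed.

Lemma betaNl u v : beta (- u) v = beta v u.
Proof. by apply: (mulfI (beta_neq0 u v)); rewrite -betaDl subrr beta0l betaC. Qed.

Lemma betaNr u v : beta u (- v) = beta v u.
Proof. by rewrite -betaV betaNl betaV. Qed.

Lemma mulTN v : T v *m T (- v) = 1%:M.
Proof. by rewrite TD addNr T0 betaNl betaxx scale1r. Qed.

Lemma mulNT v : T (- v) *m T v = 1%:M.
Proof. by rewrite -{2}(opprK v) mulTN. Qed.

Lemma T_conj u v : T (- u) *m T v *m T u = beta u v ^+ 2 *: T v.
Proof.
rewrite -mulmxA TD -scalemxAr TD scalerA addrAC subrr add0r expr2; congr (_ * _ *: _).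
by rewrite betaDl !betaNr betaxx mul1r.
Qed.

(** Conjugation by T u multiplies T v by beta u v ^+ 2, which differs from 1 for some u. *)
Lemma trace_T v : v != 0 -> \tr (T v) = 0.
Proof.
move=> /beta_nondeg[u nu]; have : \tr (T (- u) *m T v *m T u) = \tr (T v).
  by rewrite mxtrace_mulC mulmxA mulTN mul1mx.
rewrite T_conj mxtraceZ => /eqP; rewrite -subr_eq0 -{2}(mul1r (\tr _)) -mulrBl mulf_eq0.
by rewrite subr_eq0 (negPf nu) => /eqP.
Qed.

(** Schur's lemma: an eigenspace of M is stable under all T v, hence everything. *)
Lemma T_commutant_scalar (M : 'M[C]_d) :
  (forall v, M *m T v = T v *m M) -> exists a, M = a%:M.
Proof.
move=> cM; have [a ra] : exists a, root (char_poly M) a.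
  by apply: closed_rootP; rewrite size_char_poly eqSS -lt0n.
exists a; have := ra; rewrite -eigenvalue_root_char => /eigenvalueP[w wM nw].
pose Q := kermx (M - a%:M).
have QT v : (Q *m T v <= Q)%MS.
  apply/sub_kermxP; rewrite -mulmxA mulmxBr -cM mul_mx_scalar -mul_scalar_mx -mulmxBl mulmxA.
  by rewrite mulmx_ker mul0mx.
have nQ : Q != 0.
  apply: contraNneq nw => Q0; have : (w <= Q)%MS.
    by apply/sub_kermxP; rewrite mulmxBr mul_mx_scalar wM subrr.
  by rewrite Q0 submx0.
have := T_irr QT nQ; rewrite -sub1mx => /sub_kermxP; rewrite mul1mx => /eqP.
by rewrite subr_eq0 => /eqP.
Qed.

(** The sum over conjugates commutes with every T w, so it is a scalar, which the trace
    determines. *)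
Lemma weyl_average (M : 'M[C]_d) :
  d%:R *: \sum_u T (- u) *m M *m T u = (#|V|%:R * \tr M)%:M.
Proof.
set X := \sum_u _; have [w|a eX] := T_commutant_scalar (M := X).
  rewrite -[LHS]mul1mx -(mulTN w) -mulmxA; congr (_ *m _).
  rewrite mulmx_suml mulmx_sumr [RHS](reindex_inj (addrI w)).
  apply: eq_bigr => u _ /=.
  transitivity ((T (- w) *m T (- u)) *m M *m (T u *m T w)); first by rewrite !mulmxA.
  rewrite !TD -!scalemxAl -scalemxAr scalerA -opprD !betaNl betaC scale1r.
  by rewrite addrC.
rewrite eX scale_scalar_mx; congr _%:M.
rewrite mulrC mulr_natr -[LHS](mxtrace_scalar d) -eX raddf_sum /=.
rewrite (eq_bigr (fun=> \tr M)) => [|u _]; last by rewrite mxtrace_mulC mulmxA mulTN mul1mx.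
by rewrite sumr_const mulr_natl.
Qed.

(** This inversion formula shows that the T u span all matrices. It is [weyl_average] for the matrix
    units, read entry by entry and summed against the entries of M. *)
Lemma weyl_coefficients (M : 'M[C]_d) :
  d%:R *: \sum_u \tr (M *m T (- u)) *: T u = #|V|%:R *: M.
Proof.
apply/matrixP => k l'; rewrite !mxE summxE.
have H i j : d%:R * \sum_u T (- u) i j * T u k l' = #|V|%:R * (j == k)%:R * (i == l')%:R.
  have := congr1 (fun X : 'M_d => X i l') (weyl_average (delta_mx j k)).
  rewrite !mxE summxE.
  have -> : \tr (delta_mx j k : 'M[C]_d) = (j == k)%:R.
    rewrite /mxtrace (bigD1 j) //= mxE eqxx big1 ?addr0 // => i' /negPf ni.
    by rewrite mxE ni.
  move=> e; rewrite [RHS]mulr_natr -e; congr (_ * _); apply: eq_bigr => u _.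
  rewrite mxE (bigD1 k) //= big1 ?addr0 => [|k' /negPf nk]; last first.
    by rewrite !mxE big1 ?mul0r // => j' _; rewrite !mxE nk andbF mulr0.
  rewrite mxE (bigD1 j) //= big1 ?addr0 => [|j' /negPf nj]; last first.
    by rewrite !mxE nj mulr0.
  by rewrite mxE !eqxx mulr1.
transitivity (\sum_u \sum_j \sum_i d%:R * (M j i * T (- u) i j * T u k l')).
  rewrite mulr_sumr; apply: eq_bigr => u _; rewrite mxE mulr_suml mulr_sumr.
  by apply: eq_bigr => j _; rewrite mxE mulr_suml mulr_sumr.
transitivity (\sum_j \sum_i M j i * (#|V|%:R * (j == k)%:R * (i == l')%:R)).
  rewrite exchange_big; apply: eq_bigr => j _; rewrite exchange_big.
  apply: eq_bigr => i _; rewrite -H mulrCA mulr_sumr mulr_sumr.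
  by apply: eq_bigr => u _; rewrite !mulrA.
rewrite (bigD1 k) //= [X in _ + X]big1 ?addr0 => [|j /negPf nj]; last first.
  by apply: big1 => i _; rewrite nj mulr0 mul0r mulr0.
rewrite (bigD1 l') //= big1 ?addr0 => [|i /negPf ni]; last by rewrite ni !mulr0.
by rewrite !eqxx !mulr1 mulrC.
Qed.

(** In the trace of the inversion formula at the identity, only u = 0 contributes. *)
Lemma card_weyl : #|V| = (d ^ 2)%N.
Proof.
have := congr1 mxtrace (weyl_coefficients 1%:M).
rewrite !mxtraceZ mxtrace1 raddf_sum (bigD1 0) //= big1 ?addr0 => [|u nu]; last first.
  by rewrite mxtraceZ trace_T ?mulr0.
rewrite mul1mx oppr0 T0 mxtraceZ mxtrace1 -!natrM => /eqP.
by rewrite Num.Theory.eqr_nat mulnA eqn_pmul2r // => /eqP <-; rewrite expnS expn1.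
Qed.

Variables (I : finType) (rep : I -> V) (gT : finGroupType) (G : {group gT}).
Variables (act : gT -> V -> V) (W : gT -> 'M[C]_d).
Hypothesis actM : forall g g' v, act (g * g')%g v = act g' (act g v).
Hypothesis W_unit : forall g, g \in G -> W g \in unitmx.
Hypothesis W_T : forall g v, g \in G -> invmx (W g) *m T v *m W g = T (act g v).
Hypothesis rep_surj : forall v, exists i, exists2 g, g \in G & act g (rep i) = v.

(** Averaging the expansion of M over conjugation by G replaces each T v by a sum over its orbit.
    Summing over G instead of over the orbit avoids stabilizers; it only rescales the sum. *)
Lemma commutant_orbit_sums (M : 'M[C]_d) :
    (forall g, g \in G -> M *m W g = W g *m M) ->
  exists x : I -> C, M = \sum_i x i *: \sum_(g in G) T (act g (rep i)).
Proof.
move=> cM.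
have d0 : d%:R != 0 :> C by rewrite Num.Theory.pnatr_eq0 -lt0n.
have V0 : #|V|%:R != 0 :> C.
  by rewrite Num.Theory.pnatr_eq0 -lt0n; apply/card_gt0P; exists 0.
have G0 : #|G|%:R != 0 :> C by rewrite Num.Theory.pnatr_eq0 -lt0n cardG_gt0.
have rP v : exists i, [exists g in G, act g (rep i) == v].
  by have [i [g Gg e]] := rep_surj v; exists i; apply/existsP; exists g; rewrite Gg e /=.
pose r v := xchoose (rP v).
have sumr v : \sum_(g in G) T (act g v) = \sum_(g in G) T (act g (rep (r v))).
  have /exists_inP[g0 Gg0 /eqP eg0] := xchooseP (rP v); rewrite -/(r v) in eg0.
  rewrite [RHS](reindex_inj (mulgI g0)) /= -{1}eg0.
  by apply: eq_big => [g|g _]; rewrite ?actM // groupMl.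
pose c v := \tr (M *m T (- v)).
have MG g : g \in G -> invmx (W g) *m M *m W g = M.
  by move=> Gg; rewrite -mulmxA cM // mulKmx ?W_unit.
have e1 : #|G|%:R *: (#|V|%:R *: M) =
    \sum_i (d%:R * \sum_(v | r v == i) c v) *: \sum_(g in G) T (act g (rep i)).
  rewrite scaler_nat -sumr_const -[X in _ *: X]/(M).
  transitivity (\sum_(g in G) d%:R *: \sum_v c v *: T (act g v)).
    apply: eq_bigr => g Gg; rewrite -{1}(MG g Gg) scalemxAl scalemxAr -weyl_coefficients.
    rewrite -scalemxAr -scalemxAl mulmx_sumr mulmx_suml; congr (_ *: _).
    by apply: eq_bigr => v _; rewrite -scalemxAr -scalemxAl W_T.
  rewrite -scaler_sumr exchange_big (partition_big r predT) //= scaler_sumr.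
  apply: eq_bigr => i _; rewrite -scalerA; congr (_ *: _); rewrite scaler_suml.
  by apply: eq_bigr => v /eqP <-; rewrite -scaler_sumr sumr.
exists (fun i => #|V|%:R^-1 * (#|G|%:R^-1 * (d%:R * \sum_(v | r v == i) c v))).
apply: (scalerI V0); apply: (scalerI G0); rewrite e1 scaler_sumr [RHS]scaler_sumr.
apply: eq_bigr => i _; rewrite !scalerA; congr (_ *: _).
by rewrite -mulrA !mulVKf.
Qed.

End Weyl.

(** * Simple submodules and the commutant *)

(** For a full-rank factorization P = X Y, the relation P P = P cancels to Y X = 1, of size the
    rank. *)
Lemma mxtrace_idempotent (K : fieldType) d (P : 'M[K]_d) :
  P *m P = P -> \tr P = (\rank P)%:R.
Proof.
move=> PP; have RC1 : row_base P *m col_base P = 1%:M.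
  have [B BC] : exists B, B *m col_base P = 1%:M by apply/row_fullP; apply: col_base_full.
  have [B' RB] : exists B', row_base P *m B' = 1%:M by apply/row_freeP; apply: row_base_free.
  have XY : (col_base P *m row_base P) *m (col_base P *m row_base P) = col_base P *m row_base P.
    by rewrite mulmx_base.
  move: (col_base P) (row_base P) BC RB XY => X Y BX YB XY.
  have : B *m ((X *m Y) *m (X *m Y)) *m B' = B *m (X *m Y) *m B' by rewrite XY.
  by rewrite !mulmxA BX mul1mx -!mulmxA YB mulmx1.
by rewrite -(mxtrace1 K) -RC1 mxtrace_mulC mulmx_base.
Qed.

Section SimpleModules.

Variables (C : numClosedFieldType) (gT : finGroupType) (G : {group gT}).

Lemma char0_completely_reducible d (rG : mx_representation C G d) :
  mx_completely_reducible rG 1%:M.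
Proof.
apply: mx_Maschke_pchar.
by rewrite /pgroup.pgroup pcharf'_nat Num.Theory.pnatr_eq0 -lt0n cardG_gt0.
Qed.

Lemma simple_rsim d1 d2 (rG1 : mx_representation C G d1) (rG2 : mx_representation C G d2) k :
    mx_rsim rG1 rG2 ->
  (exists2 Y, mxsimple rG1 Y & \rank Y = k) -> exists2 Y, mxsimple rG2 Y & \rank Y = k.
Proof.
case=> B e12; case: d2 / e12 rG2 B => rG2 B fB homB [Y [modY nzY simY] rY].
rewrite row_free_unit in fB.
have modB (X : 'M_d1) : mxmodule rG1 X -> mxmodule rG2 (X *m B).
  move=> /mxmoduleP mX; apply/mxmoduleP => g Gg.
  by rewrite -mulmxA -homB // mulmxA submxMr // mX.
have modB' (X : 'M_d1) : mxmodule rG2 X -> mxmodule rG1 (X *m invmx B).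
  move=> /mxmoduleP mX; apply/mxmoduleP => g Gg.
  have -> : X *m invmx B *m rG1 g = X *m rG2 g *m invmx B.
    by rewrite -!mulmxA; congr (_ *m _); rewrite -[LHS](mulmxK fB) -(mulmxA _ _ B) homB // mulKmx.
  by rewrite submxMr // mX.
exists (Y *m B); last by rewrite mxrankMfree // row_free_unit.
split=> [||X modX XY nzX]; first exact: modB.
  by rewrite -mxrank_eq0 mxrankMfree ?row_free_unit // mxrank_eq0.
rewrite -[X](mulmxKV fB) submxMr // simY ?modB' //.
  by rewrite -[Y](mulmxK fB) submxMr.
by apply: contraNneq nzX => X0; rewrite -[X](mulmxKV fB) X0 mul0mx.
Qed.

Lemma simple_submod d (rG : mx_representation C G d) (U : 'M_d) (modU : mxmodule rG U) k :
  (exists2 Y, mxsimple (submod_repr modU) Y & \rank Y = k) <->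
  (exists Y, [/\ mxsimple rG Y, (Y <= U)%MS & \rank Y = k]).
Proof.
have vfree : row_free (val_submod (U := U) 1%:M) by rewrite /row_free val_submod1.
split=> [[Y [modY nzY simY] rY]|[Y [[modY nzY simY] YU rY]]].
  exists <<val_submod Y>>%MS; split; last 2 first.
  - by rewrite genmxE val_submodP.
  - by rewrite genmxE val_submodE mxrankMfree.
  split=> [||X modX]; first by rewrite (eqmx_module _ (genmxE _)) val_submod_module.
    by rewrite -mxrank_eq0 genmxE val_submodE mxrankMfree // mxrank_eq0.
  rewrite !genmxE => XY nzX; have XU := submx_trans XY (val_submodP Y).
  rewrite -(in_submodK XU) val_submodS -(genmxE (in_submod U X)) simY //.
  - by rewrite (eqmx_module _ (genmxE _)) in_submod_module.
  - by rewrite genmxE -val_submodS in_submodK.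
  - by rewrite -mxrank_eq0 genmxE mxrank_in_submod // mxrank_eq0.
exists <<in_submod U Y>>%MS; last by rewrite genmxE mxrank_in_submod.
split=> [||X modX]; first by rewrite (eqmx_module _ (genmxE _)) in_submod_module.
  by rewrite -mxrank_eq0 genmxE mxrank_in_submod // mxrank_eq0.
rewrite !genmxE -val_submodS in_submodK // => XY nzX.
rewrite -val_submodS in_submodK // -(genmxE (val_submod X)) simY ?genmxE //.
  by rewrite (eqmx_module _ (genmxE _)) val_submod_module.
by rewrite -mxrank_eq0 genmxE val_submodE mxrankMfree // mxrank_eq0.
Qed.

(** By complete reducibility P has a complement Y in Q; it has the dimension of Q / P and is simple
    because nothing lies strictly between P and Q. Conversely a simple Y is the factor Y / 0. *)
Lemma irr_constituent_dimP d (rG : mx_representation C G d) k :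
  irr_constituent_dim rG k <-> exists2 Y, mxsimple rG Y & \rank Y = k.
Proof.
split=> [[rho [irr_rho [P [Q [modP [modQ [PQ sim]]]]]]]|[Y simY rY]].
  have /(max_submodP modP modQ PQ)[ltPQ maxPQ] := mx_rsim_irr (mx_rsim_sym sim) irr_rho.
  have [Y modY defQ dxPY] :=
    mx_reducibleS modQ (submx1 Q) (@char0_completely_reducible _ rG) modP PQ.
  have rQ : \rank Q = (\rank P + \rank Y)%N by rewrite -defQ (mxdirectP dxPY).
  have YQ : (Y <= Q)%MS by rewrite -defQ addsmxSr.
  have rY : \rank Y = k.
    rewrite -(mxrank_rsim sim) genmxE; apply: (@addIn (\rank P)).
    by rewrite mxrank_in_factmod (addsmx_idPr PQ) rQ addnC.
  have PY0 : (P :&: Y = 0)%MS by apply/mxdirect_addsP.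
  exists Y => //; apply/mxsimpleP; split=> //.
    apply: contraTneq ltPQ => Y0; rewrite ltmxErank rQ Y0.
    by rewrite mxrank0 addn0 ltnn andbF.
  case=> X /and4P[modX XY nzX ltX].
  have PX0 : (P :&: X = 0)%MS.
    by apply/eqP; rewrite -submx0 -PY0 capmxS.
  have rPX : \rank (P + X)%MS = (\rank P + \rank X)%N.
    by rewrite (mxdirectP _) //; apply/mxdirect_addsP.
  apply: (maxPQ (P + X)%MS); split; first exact: addsmx_module.
    by rewrite ltmxErank addsmxSl rPX -[X in (X < _)%N]addn0 ltn_add2l lt0n mxrank_eq0.
  by rewrite ltmxErank addsmx_sub PQ (submx_trans XY) // rPX rQ ltn_add2l.
have mod0 := mxmodule0 rG d; have [modY _ _] := simY.
suff [s ers] : exists s : mx_representation C G k, mx_rsim (section_repr mod0 modY) s.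
  exists s; split; last by exists 0, Y, mod0, modY; split; rewrite ?sub0mx.
  apply: mx_rsim_irr ers _; apply/max_submodP; first exact: sub0mx.
  split=> [|X [modX]]; first by rewrite lt0mx; case: simY.
  rewrite lt0mx => nzX /andP[XY /negP]; apply.
  by case: simY => _ _; apply.
have ek : \rank <<in_factmod (0 : 'M_d) Y>>%MS = k.
  rewrite genmxE -rY; apply: (@addIn (\rank (0 : 'M[C]_d))).
  by rewrite mxrank_in_factmod adds0mx mxrank0 addn0.
by case: k / ek {rY}; exists (section_repr mod0 modY); apply: mx_rsim_refl.
Qed.

Section Commutant.

Variables (d : nat) (rG : mx_representation C G d).

Definition commutant (M : 'M[C]_d) := forall g, g \in G -> M *m rG g = rG g *m M.

Lemma commutantM M N : commutant M -> commutant N -> commutant (M *m N).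
Proof. by move=> cM cN g Gg; rewrite -mulmxA cN // mulmxA cM // mulmxA. Qed.

Lemma commutantD M N : commutant M -> commutant N -> commutant (M + N).
Proof. by move=> cM cN g Gg; rewrite mulmxDl mulmxDr cM // cN. Qed.

Lemma commutantZ a M : commutant M -> commutant (a *: M).
Proof. by move=> cM g Gg; rewrite -scalemxAl cM // scalemxAr. Qed.

Lemma commutant1 : commutant 1%:M.
Proof. by move=> g Gg; rewrite mul1mx mulmx1. Qed.

Lemma commutant_module M : commutant M -> mxmodule rG M.
Proof. by move=> cM; apply/mxmoduleP => g Gg; rewrite cM // submxMl. Qed.

(** Schur's lemma inside [Y]: M has an eigenvector there, and its eigenspace meets Y in a nonzero
    submodule. *)
Lemma commutant_eigenvalue Y M : mxsimple rG Y -> commutant M -> (Y *m M <= Y)%MS ->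
  exists a : C, Y *m M = a *: Y.
Proof.
move=> [modY nzY simY] cM YM.
pose M' := in_submod Y (val_submod (U := Y) 1%:M *m M).
have [a ra] : exists a, root (char_poly M') a.
  by apply: closed_rootP; rewrite size_char_poly eqSS mxrank_eq0.
have := ra; rewrite -eigenvalue_root_char => /eigenvalueP[w wM nw]; exists a.
have YM1 m (X : 'M_(m, d)) : (X <= Y)%MS -> (X *m M <= Y)%MS.
  by move=> XY; apply: submx_trans YM; apply: submxMr.
have wM1 : val_submod w *m M = a *: val_submod w.
  rewrite -linearZ /= -wM (val_submodE (w *m _)) -mulmxA -val_submodE in_submodK.
    by rewrite mulmxA -val_submodE.
  by rewrite YM1 // val_submod1.
pose X := (Y :&: kermx (M - a%:M))%MS.
have modX : mxmodule rG X.
  apply: capmx_module => //; apply/mxmoduleP => g Gg; apply/sub_kermxP.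
  have -> : kermx (M - a%:M) *m rG g *m (M - a%:M) = kermx (M - a%:M) *m (M - a%:M) *m rG g.
    by rewrite -!mulmxA; congr (_ *m _); rewrite mulmxBl mulmxBr cM // scalar_mxC.
  by rewrite mulmx_ker mul0mx.
have nzX : X != 0.
  apply: contraNneq nw => X0; rewrite -(@val_submod_eq0 _ _ Y) -submx0 -X0 sub_capmx val_submodP.
  by apply/sub_kermxP; rewrite mulmxBr wM1 mul_mx_scalar subrr.
have := simY _ modX (capmxSl _ _) nzX; rewrite sub_capmx => /andP[_ /sub_kermxP].
by rewrite mulmxBr mul_mx_scalar => /eqP; rewrite subr_eq0 => /eqP.
Qed.

Lemma simple_projection (Y : 'M_d) : mxmodule rG Y ->
  exists P : 'M_d, [/\ commutant P, P *m P = P & (P :=: Y)%MS].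
Proof.
move=> modY; have [Z modZ defZ dxYZ] := @char0_completely_reducible _ rG Y modY (submx1 Y).
have YZ0 : (Y :&: Z = 0)%MS by apply/mxdirect_addsP.
exists (proj_mx Y Z); split.
- move=> g Gg; have /hom_mxP := proj_mx_hom YZ0 modY modZ.
  have : (1%:M <= Y + Z)%MS by rewrite defZ.
  move=> le1 H; have /hom_mxP/(_ g Gg) := submx_trans le1 (proj_mx_hom YZ0 modY modZ).
  by rewrite !mul1mx.
- exact: proj_mx_proj.
- apply/eqmxP; rewrite -{1}[proj_mx Y Z]mul1mx proj_mx_sub /=.
  by rewrite -{1}(proj_mx_id YZ0 (submx_refl Y)) submxMl.
Qed.

(* On a simple [Y] in the image of [E], each [X i] acts by a scalar [chi i]; by
   orthogonality the projection onto [Y] is [\sum_i c i *: E *m X i] with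
   [c i * \tr E = (chi i)^-1 * \rank Y], and it acts on [Y] as the identity. *)
Lemma simple_rank_orthogonal (I : finType) (E : 'M_d) (X X' : I -> 'M_d) Y :
    commutant E -> (forall i, commutant (X i)) ->
    (forall i, X i *m E = E *m X i) -> (forall i j, X i *m X j = X j *m X i) ->
    (forall i, X i *m X' i = 1%:M) ->
    (forall i j, i != j -> \tr (E *m X i *m X' j) = 0) ->
    (forall M, commutant M -> exists c : I -> C, M *m E = \sum_i c i *: (E *m X i)) ->
    mxsimple rG Y -> Y *m E = Y ->
  (#|I| * \rank Y)%:R = \tr E.
Proof.
move=> cE cX XE XX XX' ort span simY YE.
have [modY nzY _] := simY; have [P [cP PP PY]] := simple_projection modY.
have rP : \tr P = (\rank Y)%:R by rewrite mxtrace_idempotent // PY.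
have inY (M : 'M_d) : Y *m M = Y -> P *m M = P.
  by move=> YM; have /submxP[D ->] : (P <= Y)%MS; rewrite ?PY // -mulmxA YM.
have PE : P *m E = P by apply: inY.
have [c] := span P cP; rewrite PE => eP.
have PX i : P *m X i = X i *m P.
  rewrite eP mulmx_sumr mulmx_suml; apply: eq_bigr => j _.
  by rewrite -scalemxAr -scalemxAl mulmxA XE -!mulmxA XX.
have YP : Y *m P = Y by have /submxP[D ->] : (Y <= P)%MS; rewrite ?PY // -mulmxA PP.
have chiP i : {a | P *m X i == a *: P}.
  apply: sigW; have [|a ea] := commutant_eigenvalue simY (cX i).
    by rewrite -{1}YP -mulmxA PX mulmxA -PY submxMl.
  exists a; have /submxP[D ->] : (P <= Y)%MS by rewrite PY.
  by rewrite -mulmxA ea scalemxAr.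
pose chi i := sval (chiP i).
have chiE i : P *m X i = chi i *: P by apply/eqP/(svalP (chiP i)).
(* X i *m X' i = 1 is inserted into the trace of P; P absorbs X i as chi i, and orthogonality
   isolates c i in the trace of P *m X' i. *)
have cE' i : chi i * (c i * \tr E) = (\rank Y)%:R.
  rewrite -rP -[in RHS](mulmx1 P) -(XX' i) mulmxA chiE -scalemxAl mxtraceZ; congr (_ * _).
  rewrite eP mulmx_suml raddf_sum (bigD1 i) //= big1 ?addr0 => [|j ji].
    by rewrite -scalemxAl mxtraceZ -mulmxA XX' mulmx1.
  by rewrite -scalemxAl mxtraceZ ort ?mulr0.
have sum1 : \sum_i chi i * c i = 1.
  have nzP : P != 0 by rewrite -mxrank_eq0 PY mxrank_eq0.
  have : (\sum_i chi i * c i) *: P = P.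
    rewrite -{2}PP {3}eP mulmx_sumr scaler_suml; apply: eq_bigr => i _.
    by rewrite -scalemxAr mulmxA PE chiE scalerA mulrC.
  move/eqP; rewrite -subr_eq0 -[X in _ - X]scale1r -scalerBl scaler_eq0 (negPf nzP) orbF.
  by rewrite subr_eq0 => /eqP.
(* Each of the #|I| summands equals the rank of Y, by the two relations above. *)
have -> : \tr E = \sum_i chi i * c i * \tr E by rewrite -mulr_suml sum1 mul1r.
rewrite natrM mulr_natl -sumr_const.
by apply: eq_bigr => i _; rewrite -(cE' i) mulrA.
Qed.

(** Here 1 and J need not be orthogonal for the trace. With eps the eigenvalue of J on Y, the two
    coefficients of the projection P are eliminated from the traces of P and P J = eps P and from P
    P = P. *)
Lemma simple_rank_involution (E J : 'M_d) Y :
    commutant E -> commutant J -> E *m E = E -> J *m E = E *m J -> J *m J = 1%:M ->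
    (forall M, commutant M -> exists c : bool -> C,
       M *m E = \sum_b c b *: (E *m (if b then J else 1%:M))) ->
    mxsimple rG Y -> Y *m E = Y ->
  exists2 eps : C, eps ^+ 2 = 1 & Y *m J = eps *: Y /\ (2 * \rank Y)%:R = \tr E + eps * \tr (E *m J).
Proof.
move=> cE cJ EE JE JJ span simY YE.
have [modY nzY _] := simY; have [P [cP PP PY]] := simple_projection modY.
have rP : \tr P = (\rank Y)%:R by rewrite mxtrace_idempotent // PY.
have nzP : P != 0 by rewrite -mxrank_eq0 PY mxrank_eq0.
have inY (M N : 'M_d) : Y *m M = Y *m N -> P *m M = P *m N.
  by move=> YM; have /submxP[D ->] : (P <= Y)%MS; rewrite ?PY // -!mulmxA YM.
have PE : P *m E = P by rewrite -[RHS]mulmx1; apply: inY; rewrite YE mulmx1.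
have [c] := span P cP; rewrite PE big_bool /= mulmx1 => eP.
have PJ : P *m J = J *m P.
  rewrite eP mulmxDl mulmxDr -!scalemxAl -!scalemxAr JE -mulmxA; congr (_ + _).
  by rewrite [in RHS]mulmxA JE -mulmxA.
have YP : Y *m P = Y by have /submxP[D ->] : (Y <= P)%MS; rewrite ?PY // -mulmxA PP.
have [|eps ea] := commutant_eigenvalue simY cJ.
  by rewrite -{1}YP -mulmxA PJ mulmxA -PY submxMl.
have PJe : P *m J = eps *: P.
  by rewrite (inY J eps%:M) ?mul_mx_scalar // ea.
have eps2 : eps ^+ 2 = 1.
  have : eps ^+ 2 *: P = P.
    have : eps *: (eps *: P) = P by rewrite -PJe scalemxAl -PJe -mulmxA JJ mulmx1.
    by move=> eeP; rewrite expr2 -{2}eeP; apply/matrixP => i j; rewrite !mxE mulrA.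
  move/eqP; rewrite -subr_eq0 -[X in _ - X]scale1r -scalerBl scaler_eq0 (negPf nzP) orbF.
  by rewrite subr_eq0 => /eqP.
exists eps => //; split=> //.
have e1 : \tr P = c true * \tr (E *m J) + c false * \tr E by rewrite {1}eP mxtraceD !mxtraceZ.
have e2 : eps * \tr P = c true * \tr E + c false * \tr (E *m J).
  rewrite -[LHS]mxtraceZ -PJe {1}eP mulmxDl -!scalemxAl mxtraceD !mxtraceZ.
  by rewrite -mulmxA JJ mulmx1.
have e3 : c true * eps + c false = 1.
  have : (c true * eps + c false) *: P = P.
    rewrite -[RHS]PP {3}eP mulmxDr -!scalemxAr mulmxA PE PJe scalerA -scalerDl.
    by [].
  move/eqP; rewrite -subr_eq0 -[X in _ - X]scale1r -scalerBl scaler_eq0 (negPf nzP) orbF.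
  by rewrite subr_eq0 => /eqP.
rewrite natrM -rP.
transitivity (\tr P + eps ^+ 2 * \tr P); first by rewrite eps2; ring.
transitivity ((c true * eps + c false) * (\tr E + eps * \tr (E *m J))
   + c true * \tr (E *m J) * (1 - eps ^+ 2)); last by rewrite e3 eps2; ring.
by rewrite expr2 -[eps * eps * _]mulrA e2 e1; ring.
Qed.


End Commutant.

End SimpleModules.

(** * The layers of the Weil module *)

(** Traces live in the field C and the claimed dimensions in [rat]; [K] is generic so that
    equalities can pass from one to the other through natural numbers. *)
Lemma natr_double_succ (K : numDomainType) r m :
  (2 * r)%:R = m%:R + 1 :> K <-> (2 * r)%N = m.+1.
Proof. by rewrite natr1; split=> [/eqP|->//]; rewrite Num.Theory.eqr_nat => /eqP. Qed.

Lemma natr_double_pred (K : numDomainType) r m :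
  (2 * r)%:R = m%:R - 1 :> K <-> (2 * r).+1 = m.
Proof.
split=> [/eqP|<-]; last by rewrite -natr1 addrK.
by rewrite -subr_eq opprK natr1 Num.Theory.eqr_nat => /eqP.
Qed.

Lemma natr_half (K : numFieldType) r (x : K) : r%:R = x / 2 <-> (2 * r)%:R = x.
Proof.
have n2 : 2 != 0 :> K by rewrite Num.Theory.pnatr_eq0.
rewrite natrM; split=> [->|<-]; first by rewrite mulrC divfK.
by rewrite [2 * _]mulrC mulfK.
Qed.

Lemma weil_dimsP q n m (x : rat) : reflect
  ((exists2 j, (2 <= j <= m)%N & x = layer_dim q n j) \/ x \in base_dims q n)
  (x \in weil_dims q n m).
Proof.
rewrite mem_cat; apply: (iffP orP) => -[H|]; try by right.
  left; case/mapP: H => j; rewrite mem_rev mem_iota => jm ->; exists j => //; lia.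
case: H => j jm ->; left; apply: map_f; rewrite mem_rev mem_iota; lia.
Qed.

Lemma behead_weil_dims q n m : (1 < m)%N -> behead (weil_dims q n m) = weil_dims q n m.-1.
Proof.
case: m => [|[|m]] // _; rewrite /weil_dims (_ : m.+2 - 1 = m + 1)%N; last by lia.
by rewrite iotaD rev_cat subn1.
Qed.

Section WeilLayers.

Variables (F : finFieldType) (A : finComUnitRingType).
Variables (star : {rmorphism A -> A}) (pi : A) (l : nat) (dig : F -> A).
Hypothesis chainA : ramified_chain star pi l dig.
Variables (V : finLmodType A) (n : nat).
Hypothesis n_gt0 : (0 < n)%N.
Hypothesis freeV : free_of_rank V (2 * n).
Variable h : V -> V -> A.
Hypothesis hP : nondegenerate_skew_hermitian star h.
Variables (C : numClosedFieldType) (psi : A -> C).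
Hypothesis psi0 : psi 0 = 1.
Hypothesis psiD : forall a b, psi (a + b) = psi a * psi b.
Hypothesis psi_star : forall a, psi (star a) = psi a.
Hypothesis psi_nondeg : forall b, b != 0 -> exists a, psi (a * b) != 1.
Variables (d : nat) (T : V -> 'M[C]_d).
Hypothesis d_gt0 : (0 < d)%N.
Hypothesis T0 : T 0 = 1%:M.
Hypothesis TD : forall u v, T v *m T u = psi (h u v) *: T (u + v).
Hypothesis T_irr :
  forall M : 'M[C]_d, (forall v, (M *m T v <= M)%MS) -> M != 0 -> row_full M.
Variable W : mx_representation C (unitary_group h) d.
Hypothesis W_T : forall g v, g \in unitary_group h ->
  invmx (W g) *m T v *m W g = T (g v).

Let beta u v := psi (h u v).
Let l_gt0 := chain_gt0 chainA.
Let m_gt0 : (0 < 2 * n)%N. Proof. by rewrite muln_gt0. Qed.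
Local Notation q := #|F|.

(** Of the two halves of e, one may be replaced by its [star], which cancels the other. *)
Lemma psi_skew e : e \in skew star -> psi e = 1.
Proof.
move=> /skewP se; have s2 : star (e / 2) = - (e / 2).
  by rewrite (star_half chainA) se mulNr.
have e2 : e / 2 + e / 2 = e by rewrite -mulrDl (double_half chainA).
by rewrite -{1}e2 psiD -{1}psi_star s2 -psiD addNr.
Qed.

Lemma beta_Dl u v w : beta (u + v) w = beta u w * beta v w.
Proof. by rewrite /beta (hermDl hP) psiD. Qed.

Lemma beta_C u v : beta u v * beta v u = 1.
Proof.
rewrite /beta -psiD (hermC hP u v); apply: psi_skew; apply/skewP.
by rewrite rmorphB /= (chain_starK chainA); ring.
Qed.

Lemma beta_xx v : beta v v = 1.
Proof. exact: psi_skew (herm_skew hP v). Qed.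

Lemma beta_sqr v : v != 0 -> exists u, beta u v ^+ 2 != 1.
Proof.
move=> nv; have [/existsP[u nu]|/existsPn H] := boolP [exists u, h u v != 0]; last first.
  case/eqP: nv; apply: (herm_nondeg hP) => u; rewrite (hermC hP u).
  by rewrite (eqP (negPn (H u))) rmorph0 oppr0.
(* The factor 1/2 in the witness absorbs the square, and [star] undoes the semilinearity of h in its
   first variable. *)
have [a na] := psi_nondeg nu; exists (star (a / 2) *: u).
rewrite /beta (hermZl hP) (chain_starK chainA) expr2 -psiD -mulrDl -mulrDl.
by rewrite (double_half chainA).
Qed.

Let T_N := mulTN T0 TD beta_Dl beta_C beta_xx.
Let N_T := mulNT T0 TD beta_Dl beta_C beta_xx.

Lemma card_V_eq : #|V| = ((q ^ (2 * l - 1)) ^ (2 * n))%N.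
Proof. exact (card_free chainA freeV). Qed.

Lemma dim_weil : d = (q ^ ((2 * l - 1) * n))%N.
Proof.
have := card_weyl d_gt0 T0 TD beta_Dl beta_C beta_xx beta_sqr T_irr.
rewrite card_V_eq -expnM (mulnC 2 n) mulnA expnM => /eqP.
by rewrite eqn_exp2r // => /eqP <-.
Qed.

(** * Averages over the isotropic layers *)

(* For [i < l] this submodule is isotropic and [pi^i V] is its orthogonal. *)
Definition isotropic_layer i := scaled_submodule V (pi ^+ (2 * l - 1 - i)).

Lemma isotropic_layerD i u v :
  u \in isotropic_layer i -> v \in isotropic_layer i -> u + v \in isotropic_layer i.
Proof. by move=> /imsetP[x _ ->] /imsetP[y _ ->]; rewrite -scalerDr imset_f. Qed.

Lemma isotropic_layerN i u : u \in isotropic_layer i -> - u \in isotropic_layer i.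
Proof. by move=> /imsetP[x _ ->]; rewrite -scalerN imset_f. Qed.

Lemma isotropic_layer0 i : 0 \in isotropic_layer i.
Proof. by apply/imsetP; exists 0; rewrite ?scaler0. Qed.

Lemma isotropic_layerS i j u : (i <= j)%N ->
  u \in isotropic_layer i -> u \in isotropic_layer j.
Proof.
move=> ij /imsetP[x _ ->]; apply/imsetP.
exists (pi ^+ (2 * l - 1 - i - (2 * l - 1 - j)) *: x) => //.
by rewrite scalerA -exprD; congr (pi ^+ _ *: _); lia.
Qed.

Lemma card_isotropic_layer i : (i <= 2 * l - 1)%N ->
  #|isotropic_layer i| = (q ^ (i * (2 * n)))%N.
Proof.
by move=> il; rewrite (card_scaled_layer chainA freeV) ?leq_subr // subKn // -expnM.
Qed.

Lemma herm_layer i j x y : (2 * l - 1 <= i + j)%N -> h (pi ^+ i *: x) (pi ^+ j *: y) = 0.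
Proof.
move=> le; rewrite (hermZl hP) (hermZr hP) (star_pi_exp chainA).
transitivity ((-1) ^+ i * pi ^+ (i + j) * h x y); first by rewrite exprD; ring.
by rewrite (pi_exp_eq0 chainA) // mulr0 mul0r.
Qed.

Definition average i : 'M[C]_d :=
  #|isotropic_layer i|%:R^-1 *: \sum_(v in isotropic_layer i) T v.

Lemma card_layer_neq0 i : #|isotropic_layer i|%:R != 0 :> C.
Proof.
rewrite Num.Theory.pnatr_eq0 -lt0n; apply/card_gt0P; exists 0; exact: isotropic_layer0.
Qed.

Lemma T_layer i u v : (i < l)%N -> u \in isotropic_layer i -> v \in isotropic_layer i ->
  T v *m T u = T (u + v).
Proof.
move=> il /imsetP[x _ ->] /imsetP[y _ ->].
by rewrite TD herm_layer ?psi0 ?scale1r //; lia.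
Qed.

Lemma T_average i u : (i < l)%N -> u \in isotropic_layer i -> T u *m average i = average i.
Proof.
move=> il Vu; rewrite /average -scalemxAr; congr (_ *: _).
rewrite mulmx_sumr [RHS](reindex_inj (addIr u)) /=.
apply: eq_big => [v|v Vv]; last by rewrite (T_layer il).
apply/idP/idP => [Vv|Vuv]; first exact: isotropic_layerD.
by rewrite -(addrK u v) isotropic_layerD ?isotropic_layerN.
Qed.

Lemma average_T i u : (i < l)%N -> u \in isotropic_layer i -> average i *m T u = average i.
Proof.
move=> il Vu; rewrite /average -scalemxAl; congr (_ *: _).
rewrite mulmx_suml [RHS](reindex_inj (addrI u)) /=.
apply: eq_big => [v|v Vv]; last by rewrite (T_layer il).
apply/idP/idP => [Vv|Vuv]; first exact: isotropic_layerD.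
by rewrite -(addKr u v) isotropic_layerD ?isotropic_layerN.
Qed.

Lemma average_fix m (M : 'M[C]_(m, d)) i :
  (forall u, u \in isotropic_layer i -> M *m T u = M) -> M *m average i = M.
Proof.
move=> fixM; rewrite /average -scalemxAr mulmx_sumr (eq_bigr (fun=> M)) //.
by rewrite sumr_const -scaler_nat scalerA mulVf ?card_layer_neq0 ?scale1r.
Qed.

Lemma average_fixl (M : 'M[C]_d) i :
  (forall u, u \in isotropic_layer i -> T u *m M = M) -> average i *m M = M.
Proof.
move=> fixM; rewrite /average -scalemxAl mulmx_suml (eq_bigr (fun=> M)) //.
by rewrite sumr_const -scaler_nat scalerA mulVf ?card_layer_neq0 ?scale1r.
Qed.

Lemma average_mull i j : (i <= j)%N -> (j < l)%N -> average i *m average j = average j.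
Proof.
by move=> ij jl; apply: average_fixl => u Vu; apply: T_average (isotropic_layerS ij Vu).
Qed.

Lemma average_mulr i j : (i <= j)%N -> (j < l)%N -> average j *m average i = average j.
Proof.
by move=> ij jl; apply: average_fix => u Vu; apply: average_T (isotropic_layerS ij Vu).
Qed.

Lemma average0 : average 0 = 1%:M.
Proof.
have -> : average 0 = (#|[set 0 : V]|%:R : C)^-1 *: \sum_(v in [set 0 : V]) T v.
  rewrite /average; suff -> : isotropic_layer 0 = [set 0] by [].
  apply/setP => v; rewrite inE; apply/imsetP/eqP => [[x _ ->]|->].
    by rewrite subn0 (chain_nil chainA) scale0r.
  by exists 0; rewrite ?scaler0.
by rewrite big_set1 cards1 T0 invr1 scale1r.
Qed.

Lemma unitary_scale g a v : g \in unitary_group h -> g (a *: v) = a *: g v.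
Proof.
case/unitaryP=> gl _; have := gl a v 0; rewrite !addr0 => ->.
by have := gl (-1) 0 0; rewrite scaler0 addr0 scaleN1r addNr => ->; rewrite addr0.
Qed.

Lemma average_commutant i : commutant W (average i).
Proof.
move=> g Gg; rewrite /average -scalemxAl -scalemxAr; congr (_ *: _).
rewrite mulmx_suml mulmx_sumr [RHS](reindex_inj (@perm_inj _ g)) /=.
apply: eq_big => [v|v _].
  apply/imsetP/imsetP => [[x _ ->]|[x _ e]]; first by exists (g x); rewrite ?unitary_scale.
  exists ((g^-1)%g x) => //; apply: (@perm_inj _ g).
  by rewrite unitary_scale // permKV.
by rewrite -W_T // !mulmxA mulmxV ?mul1mx // (repr_mx_unit W Gg).
Qed.

(** Only T 0 has nonzero trace, so the trace is d divided by the size of the layer. *)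
Lemma trace_average i : (i < l)%N -> \tr (average i) = q%:R ^+ ((2 * l - 1 - 2 * i) * n).
Proof.
move=> il; rewrite /average mxtraceZ raddf_sum (bigD1 0) ?isotropic_layer0 //=.
rewrite big1 ?addr0 => [|v /andP[_ nv]]; last first.
  exact: (trace_T T0 TD beta_Dl beta_C beta_xx beta_sqr).
rewrite T0 mxtrace1 dim_weil card_isotropic_layer; last by lia.
apply: (mulfI (x := (q ^ (i * (2 * n)))%:R)).
  by rewrite Num.Theory.pnatr_eq0 -lt0n expn_gt0 ltnW // card_finNzRing_gt1.
rewrite mulrA divff ?mul1r; last first.
  by rewrite Num.Theory.pnatr_eq0 -lt0n expn_gt0 ltnW // card_finNzRing_gt1.
by rewrite -!natrX -natrM -expnD; congr (_ ^ _)%:R; nia.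
Qed.

(** * Operators of the norm-one scalars and their traces *)

Definition scalar_weil a : 'M[C]_d := W (scalar_perm V a).

Lemma scalar_weil_commutant a : a \in norm_one star -> commutant W (scalar_weil a).
Proof.
move=> Na g Gg; have Ga := scalar_perm_unitary hP Na.
have Ua : a \is a GRing.unit by move: Na; rewrite inE => /andP[].
rewrite /scalar_weil -!repr_mxM //; congr (W _); apply/permP => v.
by rewrite !permM !scalar_permE // unitary_scale.
Qed.

Lemma norm_oneM a b : a \in norm_one star -> b \in norm_one star -> a * b \in norm_one star.
Proof.
rewrite !inE => /andP[Ua /eqP aa] /andP[Ub /eqP bb].
by rewrite unitrM Ua Ub rmorphM /= mulrACA aa bb mulr1.
Qed.

Lemma norm_oneV a : a \in norm_one star -> a^-1 \in norm_one star.
Proof.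
rewrite !inE => /andP[Ua /eqP aa].
by rewrite unitrV Ua rmorphV //= -invrM ?rmorph_unit // mulrC aa invr1.
Qed.

Lemma norm_oneN a : a \in norm_one star -> - a \in norm_one star.
Proof. by rewrite !inE unitrN rmorphN mulrNN. Qed.

Lemma norm_one1 : 1 \in norm_one star.
Proof. by rewrite inE unitr1 rmorph1 mulr1 eqxx. Qed.

Lemma norm_one_unit a : a \in norm_one star -> a \is a GRing.unit.
Proof. by rewrite inE => /andP[]. Qed.

Lemma scalar_weilM a b : a \in norm_one star -> b \in norm_one star ->
  scalar_weil a *m scalar_weil b = scalar_weil (a * b).
Proof.
move=> Na Nb; rewrite /scalar_weil scalar_permM ?norm_one_unit //.
by rewrite repr_mxM ?(scalar_perm_unitary hP).
Qed.

Lemma scalar_weil1 : scalar_weil 1 = 1%:M.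
Proof.
rewrite /scalar_weil (_ : scalar_perm V 1 = 1%g) ?repr_mx1 //; apply/permP => v.
by rewrite scalar_permE ?unitr1 // perm1 scale1r.
Qed.

Lemma T_scalar_weil a v : a \in norm_one star ->
  T v *m scalar_weil a = scalar_weil a *m T (a *: v).
Proof.
move=> Na; have Ga := scalar_perm_unitary hP Na.
rewrite /scalar_weil -(scalar_permE v (norm_one_unit Na)) -W_T // !mulmxA.
by rewrite mulmxV ?mul1mx // (repr_mx_unit W Ga).
Qed.

(** Conjugation by T v fixes M and the trace. Moving T v across W(a) produces T (a^-1 v - v) with
    the scalar psi (- (a h v v)), which is 1 by assumption. *)
Lemma trace_shift M a v : a \in norm_one star -> psi (- (a * h v v)) = 1 ->
    T (- v) *m M *m T v = M ->
  \tr (M *m scalar_weil a) = \tr (M *m T (a^-1 *: v - v) *m scalar_weil a).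
Proof.
move=> Na ps MT; have Ua := norm_one_unit Na.
have MN : T (- v) *m M = M *m T (- v) by rewrite -{2}MT -mulmxA T_N mulmx1.
have WT : scalar_weil a *m T v = T (a^-1 *: v) *m scalar_weil a.
  by rewrite T_scalar_weil // scalerA divrr // scale1r.
transitivity (\tr (T (- v) *m (M *m scalar_weil a) *m T v)).
  by rewrite [RHS]mxtrace_mulC !mulmxA T_N mul1mx.
rewrite mulmxA MN -!mulmxA WT; congr (\tr (_ *m _)); rewrite mulmxA TD.
suff -> : psi (h (a^-1 *: v) (- v)) = 1 by rewrite scale1r.
rewrite (hermZl hP) (hermNr hP) mulrN.
suff -> : star a^-1 = a by [].
rewrite rmorphV //; move: Na; rewrite inE Ua => /eqP aa.
by apply: (mulIr (x := star a)); rewrite ?rmorph_unit // mulVr ?rmorph_unit.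
Qed.

Lemma T_commute_average i v : v \in scaled_submodule V (pi ^+ i) ->
  T (- v) *m average i *m T v = average i.
Proof.
move=> /imsetP[x _ ->]; rewrite /average -scalemxAr -scalemxAl; congr (_ *: _).
rewrite mulmx_sumr mulmx_suml; apply: eq_bigr => u /imsetP[y _ ->].
rewrite (T_conj TD beta_Dl beta_C beta_xx) /beta herm_layer; last by lia.
by rewrite psi0 expr1n scale1r.
Qed.

(* [average i.+1] is a mean of the [average i *m T w]. Each [w] is
   [a^-1 v - v] for some [v] in [pi^i V], and conjugation by [T v] fixes
   [average i], so that the factor [T w] does not change the trace. *)
Lemma trace_average_scalar i a k u : (i.+1 < l)%N -> a \in norm_one star ->
    u \is a GRing.unit -> a - 1 = pi ^+ k * u -> (k <= 2 * l - 3 - 2 * i)%N ->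
  \tr (average i *m scalar_weil a) = \tr (average i.+1 *m scalar_weil a).
Proof.
move=> il Na Uu ak kle; have Ua := norm_one_unit Na.
have shift w : w \in isotropic_layer i.+1 ->
    \tr (average i *m T w *m scalar_weil a) = \tr (average i *m scalar_weil a).
  move=> /imsetP[x _ ew].
  (* As w is in pi^(2l-2-i) V and a - 1 = pi^k u, this v solves (a^-1 - 1) v = w. *)
  pose v := pi ^+ (2 * l - 2 - i - k) *: ((- (a * u^-1)) *: x).
  have ewv : w = a^-1 *: v - v.
    rewrite -[X in _ - X]scale1r -scalerBl /v !scalerA ew; congr (_ *: _).
    have -> : a^-1 - 1 = - (a^-1 * (pi ^+ k * u)) by rewrite -ak mulrBr mulVr //; ring.
    transitivity (pi ^+ k * pi ^+ (2 * l - 2 - i - k) * (a^-1 * a) * (u * u^-1)); last by ring.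
    by rewrite mulVr // divrr // !mulr1 -exprD; congr (pi ^+ _); lia.
  rewrite ewv -trace_shift //; last first.
    have -> : v = pi ^+ i *: (pi ^+ (2 * l - 2 - i - k - i) *: ((- (a * u^-1)) *: x)).
      by rewrite /v scalerA -exprD; congr (pi ^+ _ *: _); lia.
    exact: T_commute_average (imset_f _ _).
  (* The bound on k is sharp here: (a - 1) h v v is a multiple of pi to the power k + 2 (2l-2-i-k),
     which is at least 2l-1 exactly when k <= 2l-3-2i. *)
  have -> : - (a * h v v) = - h v v.
    congr (- _); rewrite -[RHS]mul1r; apply/eqP; rewrite -subr_eq0 -mulrBl ak.
    rewrite /v (hermZl hP) (hermZr hP) (star_pi_exp chainA).
    set j := (_ - k)%N; move: (h _ _) => c.
    apply/eqP; transitivity (pi ^+ (k + j + j) * ((-1) ^+ j * u * c)).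
      by rewrite !exprD; ring.
    by rewrite (pi_exp_eq0 chainA) ?mul0r // /j; lia.
  exact: psi_skew (skewN (herm_skew hP v)).
rewrite -(average_mull (leqnSn i) il) [in RHS]/(average i.+1) -scalemxAr -[in RHS]scalemxAl.
rewrite [RHS]mxtraceZ mulmx_sumr mulmx_suml raddf_sum (eq_bigr (fun=> \tr (average i *m scalar_weil a))) //.
by rewrite sumr_const -[X in _ * X]mulr_natl mulKf // card_layer_neq0.
Qed.

Definition weil_parity := \tr (scalar_weil (-1)).

(** As 2 is a unit, every u has the form -2 v, and [trace_shift] with M = 1 and a = -1 removes T
    u. *)
Lemma trace_T_parity u : \tr (T u *m scalar_weil (-1)) = weil_parity.
Proof.
have N1 := norm_oneN norm_one1; pose v : V := (- 2^-1) *: u.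
have -> : u = (-1)^-1 *: v - v.
  have U2 := chain_unit2 chainA.
  rewrite invrN1 scaleN1r /v scaleNr opprK -scalerDl.
  by rewrite -[2^-1]mul1r -mulrDl divrr // scale1r.
rewrite /weil_parity -[scalar_weil _ in RHS]mul1mx [RHS](@trace_shift 1%:M _ v) ?mul1mx //.
  by rewrite mulN1r opprK; apply: psi_skew (herm_skew hP v).
by rewrite mulmx1 N_T.
Qed.

Lemma trace_average_parity i : \tr (average i *m scalar_weil (-1)) = weil_parity.
Proof.
rewrite /average -scalemxAl mulmx_suml mxtraceZ raddf_sum /=.
rewrite (eq_bigr (fun=> weil_parity)) => [|u _]; last exact: trace_T_parity.
by rewrite sumr_const -[X in _ * X]mulr_natl mulKf // card_layer_neq0.
Qed.

Lemma scalar_weil_N1K : scalar_weil (-1) *m scalar_weil (-1) = 1%:M.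
Proof.
have N1 := norm_oneN norm_one1.
by rewrite scalar_weilM // mulrNN mulr1 scalar_weil1.
Qed.

(** All coefficients of W(-1) in the inversion formula equal [weil_parity]. Multiplying the formula
    by W(-1) and taking traces gives d |V| weil_parity^2 = |V| d. *)
Lemma weil_parity_sqr : weil_parity ^+ 2 = 1.
Proof.
have := weyl_coefficients d_gt0 T0 TD beta_Dl beta_C beta_xx T_irr (scalar_weil (-1)).
rewrite (eq_bigr (fun u => weil_parity *: T u)) => [|u _]; last first.
  by rewrite mxtrace_mulC trace_T_parity.
move/(congr1 (fun M => \tr (M *m scalar_weil (-1)))).
rewrite -scaler_sumr -!scalemxAl !mxtraceZ scalar_weil_N1K mxtrace1 mulmx_suml raddf_sum /=.
rewrite (eq_bigr (fun=> weil_parity)) => [|u _]; last exact: trace_T_parity.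
rewrite sumr_const -[weil_parity *+ _]mulr_natl => e.
have d0 : d%:R != 0 :> C by rewrite Num.Theory.pnatr_eq0 -lt0n.
have V0 : #|V|%:R != 0 :> C by rewrite Num.Theory.pnatr_eq0 -lt0n; apply/card_gt0P; exists 0.
apply: (mulfI d0); apply: (mulfI V0); rewrite mulr1 -e expr2; ring.
Qed.

Lemma average_mul i j : (i < l)%N -> (j < l)%N ->
  average i *m average j = average (maxn i j).
Proof.
move=> il jl; case: leqP => ij; first exact: average_mull.
exact: average_mulr (ltnW ij) il.
Qed.

(** * The layer idempotents *)

Definition layer i := if (i.+1 < l)%N then average i - average i.+1 else average i.

Lemma layer_commutant i : commutant W (layer i).
Proof.
rewrite /layer; case: ifP => _; last exact: average_commutant.
rewrite -scaleN1r; apply: commutantD; first exact: average_commutant.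
exact: commutantZ (average_commutant _).
Qed.

Lemma average_layer i j : (i < l)%N -> (j < l)%N ->
  average i *m layer j = (i <= j)%:R *: layer j.
Proof.
move=> il jl; rewrite /layer; case: ifP => [jl'|jl'].
  rewrite mulmxBr !average_mul //; case: (leqP i j) => ij.
    by rewrite (maxn_idPr (leqW ij)) scale1r.
  by rewrite (maxn_idPl ij) subrr scale0r.
have ij : (i <= j)%N by lia.
by rewrite average_mul // (maxn_idPr ij) ij scale1r.
Qed.

Lemma layer_average i j : (i < l)%N -> (j < l)%N ->
  layer j *m average i = (i <= j)%:R *: layer j.
Proof.
move=> il jl; rewrite -average_layer // /layer; case: ifP => [jl'|jl'].
  by rewrite mulmxBr mulmxBl !average_mul // !(maxnC i).
by rewrite !average_mul // maxnC.
Qed.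

Lemma layer_mul i j : (i < l)%N -> (j < l)%N ->
  layer i *m layer j = (i == j)%:R *: layer j.
Proof.
move=> il jl; rewrite {1}/layer; case: ifP => [il'|il'].
  rewrite mulmxBl !average_layer // -scalerBl; congr (_ *: _).
  by rewrite leq_eqVlt; case: ltngtP; rewrite ?subrr ?subr0.
by rewrite average_layer //; congr (_%:R *: _); rewrite eqn_leq; lia.
Qed.

Lemma sum_layer : \sum_(i < l) layer i = 1%:M.
Proof.
have H m : (m < l)%N -> \sum_(0 <= i < m) layer i = 1%:M - average m.
  elim: m => [|m IH] ml; first by rewrite big_geq // average0 subrr.
  by rewrite big_nat_recr //= IH 1?ltnW // /layer ml addrA subrK.
have lF : (l.-1.+1 < l)%N = false by rewrite prednK ?ltnn.
rewrite -(big_mkord xpredT layer) -[X in \sum_(0 <= i < X) _](prednK l_gt0).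
by rewrite big_nat_recr //= H ?prednK // /layer lF subrK.
Qed.

Lemma trace_layer i : (i.+1 < l)%N ->
  \tr (layer i) = q%:R ^+ ((2 * l - 1 - 2 * i) * n) - q%:R ^+ ((2 * l - 3 - 2 * i) * n).
Proof.
move=> il; rewrite /layer il raddfB /= !trace_average // 1?ltnW //.
by congr (_ - _ ^+ (_ * _)); lia.
Qed.

Lemma trace_last_layer : \tr (layer l.-1) = q%:R ^+ n.
Proof.
rewrite /layer prednK // ltnn trace_average ?prednK //; congr (_ ^+ _).
by rewrite -[RHS]mul1n; congr muln; lia.
Qed.

Lemma q_gt1 : (1 < q)%N. Proof. exact: card_finNzRing_gt1. Qed.

Lemma trace_layer_neq0 i : (i < l)%N -> \tr (layer i) != 0.
Proof.
move=> il; have [il'|il'] := ltnP i.+1 l.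
  rewrite trace_layer // subr_eq0 -!natrX Num.Theory.eqr_nat eqn_exp2l ?q_gt1 //.
  by rewrite eqn_pmul2r //; lia.
have -> : i = l.-1 by lia.
by rewrite trace_last_layer -natrX Num.Theory.pnatr_eq0 -lt0n expn_gt0 ltnW ?q_gt1.
Qed.

(** * A basis of the commutant *)

(* A skew [e] with [pi^(2 i) e = w]; the default 0 of [odflt] is not reached for
   [w] in [odd_layer i]. The value at 0 makes the twists of the last layer +-1. *)
Definition skew_root i w : A :=
  if w == 0 then 0 else odflt 0 [pick e in skew star | pi ^+ (2 * i) * e == w].

Lemma skew_rootP i w : w \in odd_layer star pi i ->
  skew_root i w \in skew star /\ pi ^+ (2 * i) * skew_root i w = w.
Proof.
rewrite /skew_root => /imsetP[e se ew]; have [->|_] := eqVneq w 0.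
  by rewrite skew0 mulr0.
case: pickP => [e' /andP[? /eqP]//|/(_ e)].
by rewrite se -ew eqxx.
Qed.

Definition twist_index i : finType := (bool * {w : A | w \in odd_layer star pi i})%type.

Definition twist i (k : twist_index i) := cayley k.1 (skew_root i (val k.2)).

Lemma twist_norm_one i (k : twist_index i) : twist k \in norm_one star.
Proof.
by apply: (cayley_norm_one chainA); have [] := skew_rootP (valP k.2).
Qed.

Lemma card_twist_index i : (i < l)%N -> #|twist_index i| = (2 * q ^ (l - 1 - i))%N.
Proof.
by move=> il; rewrite card_prod card_bool card_sig (card_odd_layer chainA).
Qed.

(** The ratio of two distinct twists is close enough to 1, or far enough from it, for
    [trace_average_scalar]: its difference from 1 has valuation at most 2l-3-2i, so the two averages
    in the layer have equal traces against it. *)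
Lemma trace_layer_twist i (k k' : twist_index i) : (i.+1 < l)%N -> k != k' ->
  \tr (layer i *m scalar_weil (twist k) *m scalar_weil (twist k')^-1) = 0.
Proof.
move=> il kk'; have Nk := twist_norm_one k; have Nk' := norm_oneV (twist_norm_one k').
have Na := norm_oneM Nk Nk'.
rewrite -mulmxA scalar_weilM //.
have [j [u [Uu ej jle]]] : exists j u, [/\ u \is a GRing.unit,
    twist k / twist k' - 1 = pi ^+ j * u & (j <= 2 * l - 3 - 2 * i)%N].
  case: k k' kk' {Nk Nk' Na} => [b [w wi]] [b' [w' wi']] kk'.
  rewrite /twist /=; have [s1 e1] := skew_rootP wi; have [s2 e2] := skew_rootP wi'.
  have [bb|bb] := eqVneq b b'; last first.
    by exists 0%N, (cayley b (skew_root i w) / cayley b' (skew_root i w') - 1);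
       rewrite mul1r (cayley_ratio_neg chainA).
  have nz : pi ^+ (2 * i) * (skew_root i w - skew_root i w') != 0.
    rewrite mulrBr e1 e2 subr_eq0; apply: contra kk' => /eqP ww.
    by rewrite bb; apply/eqP; congr (_, _); apply: val_inj.
  have nz' : skew_root i w - skew_root i w' != 0 by apply: contraNneq nz => ->; rewrite mulr0.
  have [j [u [jl Uu ej]]] := pi_valuation chainA nz'.
  (* Oddness gains the missing unit: 2i + j <= 2l-2 becomes 2i + j <= 2l-3. *)
  have jodd : odd j by apply: (skew_odd chainA jl Uu); rewrite -ej skewB.
  have [u' Uu' er] := cayley_ratio chainA b s1 s2 Uu ej.
  exists j, u'; rewrite bb in er *; split=> //.
  have : (2 * i + j < 2 * l - 1)%N.
    rewrite ltnNge; apply: contra nz => /(pi_exp_eq0 chainA) z.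
    by rewrite ej mulrA -exprD z mul0r.
  lia.
rewrite /layer il mulmxBl raddfB /= (trace_average_scalar il Na Uu ej jle).
by rewrite subrr.
Qed.

Lemma last_layer_twist (k : twist_index l.-1) : twist k = if k.1 then -1 else 1.
Proof.
case: k => [b [w wi]]; rewrite /twist /=.
have w0 : w = 0.
  case/imsetP: wi => e /(skew_pi chainA)[c ->] ->.
  by rewrite mulrA -exprSr (pi_exp_eq0 chainA) ?mul0r //; lia.
rewrite w0 /skew_root eqxx /cayley addr0 subr0 divr1 mulr1.
by case: b {wi}.
Qed.

Definition orbit_index := {i : 'I_l & twist_index i}.

Definition weil_unit (x : orbit_index) :=
  layer (tag x) *m scalar_weil (twist (tagged x)).

Lemma weil_unit_commutant x : commutant W (weil_unit x).
Proof.
apply: commutantM; first exact: layer_commutant.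
by apply: scalar_weil_commutant; apply: twist_norm_one.
Qed.

Lemma layer_scalar_weil i a : a \in norm_one star ->
  scalar_weil a *m layer i = layer i *m scalar_weil a.
Proof. by move=> Na; rewrite -(layer_commutant i (scalar_perm_unitary hP Na)). Qed.

Lemma weil_unit_layer x (i : 'I_l) :
  weil_unit x *m layer i = (tag x == i)%:R *: weil_unit x.
Proof.
rewrite /weil_unit -mulmxA layer_scalar_weil ?twist_norm_one // mulmxA layer_mul //.
case: x => j k; have [ji|ji] := eqVneq j i; last first.
  by rewrite /= (negPf ji : (j == i :> nat) = false) !scale0r mul0mx.
by subst j; rewrite /= !eqxx !scale1r.
Qed.

Lemma sum_weil_unit_layer (c : orbit_index -> C) (i : 'I_l) :
  (\sum_x c x *: weil_unit x) *m layer i =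
  \sum_(k : twist_index i) c (Tagged (fun i : 'I_l => twist_index i) k) *: (layer i *m scalar_weil (twist k)).
Proof.
rewrite mulmx_suml.
transitivity (\sum_(x : orbit_index) (tag x == i)%:R *: (c x *: weil_unit x)).
  by apply: eq_bigr => x _; rewrite -scalemxAl weil_unit_layer scalerA mulrC -scalerA.
pose J := fun j : 'I_l => twist_index j.
pose G (j : 'I_l) (k : twist_index j) := (j == i)%:R *: (c (Tagged J k) *: weil_unit (Tagged J k)).
transitivity (\sum_(j : 'I_l) \sum_(k : twist_index j) G j k).
  by rewrite (sig_big_dep _ _ G); apply: eq_bigr => -[j k] _.
rewrite (bigD1 i) //= [X in _ + X]big1 ?addr0 => [|j ji]; last first.
  by apply: big1 => k _; rewrite /G (negPf ji) scale0r.
by apply: eq_bigr => k _; rewrite /G eqxx scale1r.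
Qed.

Lemma scalar_weilV a : a \in norm_one star -> scalar_weil a *m scalar_weil a^-1 = 1%:M.
Proof.
by move=> Na; rewrite scalar_weilM ?norm_oneV // divrr ?norm_one_unit // scalar_weil1.
Qed.

(** The odd layer at l-1 is {0}, so the second component is unique; [k0] supplies it. *)
Lemma sum_last_twist (k0 : twist_index l.-1) (G : twist_index l.-1 -> 'M[C]_d) :
  \sum_k G k = G (true, k0.2) + G (false, k0.2).
Proof.
have w0 : forall w, w = k0.2.
  have uw (k : twist_index l.-1) : val k.2 = 0.
    case: k => b [w /= /imsetP[e /(skew_pi chainA)[c ->] ->]].
    by rewrite mulrA -exprSr (pi_exp_eq0 chainA) ?mul0r //; lia.
  by move=> w; apply: val_inj; rewrite uw -(uw (true, w)).
transitivity (\sum_(b : bool) G (b, k0.2)); last by rewrite big_bool.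
rewrite (eq_bigr (fun k => G (k.1, k.2))) => [|[]//].
rewrite -(pair_big xpredT xpredT (fun b w => G (b, w))) /=.
apply: eq_bigr => b _; rewrite (bigD1 k0.2) //= big1 ?addr0 // => w.
by rewrite (w0 w) eqxx.
Qed.

Lemma trace_last_layer_parity : \tr (layer l.-1 *m scalar_weil (-1)) = weil_parity.
Proof. by rewrite /layer prednK // ltnn trace_average_parity. Qed.

Lemma q_exp_sqr_neq1 : (q%:R ^+ n) ^+ 2 != 1 :> C.
Proof.
rewrite -!natrX (Num.Theory.eqr_nat C _ 1) -expnM -[1%N](expn0 q).
by rewrite eqn_exp2l ?q_gt1 // muln_eq0 -leqn0 leqNgt n_gt0.
Qed.

(** The traces of the relation and of its product with W(-1) form a 2 by 2 linear system with
    determinant q^(2n) - 1 up to sign. *)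
Lemma last_layer_independent (b : twist_index l.-1 -> C) :
  \sum_k b k *: (layer l.-1 *m scalar_weil (twist k)) = 0 -> forall k, b k = 0.
Proof.
move=> b0 k0; move: b0; rewrite (sum_last_twist k0) !last_layer_twist /=.
rewrite scalar_weil1 mulmx1; set x := b (true, _); set y := b (false, _) => b0.
have e1 : x * weil_parity + y * q%:R ^+ n = 0.
  by rewrite -trace_last_layer_parity -trace_last_layer -!mxtraceZ -mxtraceD b0 linear0.
have e2 : x * q%:R ^+ n + y * weil_parity = 0.
  have := congr1 (fun M => \tr (M *m scalar_weil (-1))) b0.
  rewrite mul0mx linear0 mulmxDl -!scalemxAl mxtraceD !mxtraceZ -mulmxA scalar_weil_N1K mulmx1.
  by rewrite trace_last_layer trace_last_layer_parity.
have nz : (q%:R ^+ n) ^+ 2 - weil_parity ^+ 2 != 0 :> C.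
  by rewrite weil_parity_sqr subr_eq0 q_exp_sqr_neq1.
have x0 : x = 0.
  apply: (mulIf nz); rewrite mul0r.
  transitivity ((x * q%:R ^+ n + y * weil_parity) * q%:R ^+ n
     - (x * weil_parity + y * q%:R ^+ n) * weil_parity); first by ring.
  by rewrite e1 e2; ring.
have y0 : y = 0.
  apply: (mulIf nz); rewrite mul0r.
  transitivity ((x * weil_parity + y * q%:R ^+ n) * q%:R ^+ n
     - (x * q%:R ^+ n + y * weil_parity) * weil_parity); first by ring.
  by rewrite e1 e2; ring.
by case: k0 @x @y x0 y0 {b0 e1 e2} => [[] w] x y x0 y0.
Qed.

Lemma weil_unit_independent (c : orbit_index -> C) :
  \sum_x c x *: weil_unit x = 0 -> forall x, c x = 0.
Proof.
move=> c0 [i k0]; have il := ltn_ord i.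
pose b (k : twist_index i) := c (Tagged (fun i : 'I_l => twist_index i) k).
have b0 : \sum_k b k *: (layer i *m scalar_weil (twist k)) = 0.
  by rewrite -sum_weil_unit_layer c0 mul0mx.
change (b k0 = 0); move: b b0 => b b0.
have [il'|il'] := ltnP i.+1 l; last first.
  have ei : i = l.-1 :> nat by lia.
  move: k0 b b0 {c c0}; rewrite ei => k0 b b0; exact: last_layer_independent b0 k0.
(* The trace against the inverse twist isolates the coefficient at k0. *)
have := congr1 (fun M => \tr (M *m scalar_weil (twist k0)^-1)) b0.
rewrite mul0mx linear0 mulmx_suml raddf_sum (bigD1 k0) //= big1 ?addr0 => [|k kk0]; last first.
  by rewrite -scalemxAl mxtraceZ trace_layer_twist // mulr0.
rewrite -scalemxAl mxtraceZ -mulmxA scalar_weilV ?twist_norm_one // mulmx1 => /eqP.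
by rewrite mulf_eq0 (negPf (trace_layer_neq0 il)) orbF => /eqP.
Qed.

Lemma commutant_span M : commutant W M ->
  exists c : orbit_index -> C, M = \sum_x c x *: weil_unit x.
Proof.
move=> cM; have [u0 pu0] := exists_primitive chainA freeV m_gt0.
have [z0 uz] := primitive_pair chainA freeV m_gt0 hP pu0.
pose rep (x : orbit_index) := orbit_rep pi u0 z0 (tag x) (tagged x).1 (val (tagged x).2).
have rep_surj v : exists x, exists2 g, g \in unitary_group h & g (rep x) = v.
  have [i [b [w [il wi cv]]]] := orbit_rep_surj chainA freeV m_gt0 hP v uz.
  pose k : twist_index (Ordinal il) := (b, exist _ w wi).
  have [g Gg eg] := unitary_conj_sym cv.
  by exists (Tagged (fun i : 'I_l => twist_index i) k), g.
have orbs N : commutant W N -> exists x : orbit_index -> C,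
    N = \sum_i x i *: \sum_(g in unitary_group h) T (g (rep i)).
  move=> cN; apply: (commutant_orbit_sums d_gt0 T0 TD beta_Dl beta_C beta_xx T_irr
    (act := fun (g : {perm V}) v => g v) (W := W)) => //.
  - by move=> g g' v; rewrite permM.
  - by move=> g; apply: repr_mx_unit.
apply: (independent_family_spans (o := fun i => \sum_(g in unitary_group h) T (g (rep i)))).
- by move=> x; apply: orbs; apply: weil_unit_commutant.
- exact: weil_unit_independent.
- exact: orbs.
Qed.

Lemma commutant_span_layer M (i : 'I_l) : commutant W M ->
  exists c : twist_index i -> C, M *m layer i = \sum_k c k *: (layer i *m scalar_weil (twist k)).
Proof.
move=> /commutant_span[c ->]; exists (fun k => c (Tagged (fun i : 'I_l => twist_index i) k)).
exact: sum_weil_unit_layer.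
Qed.

Lemma layer_weil_unit x (i : 'I_l) :
  layer i *m weil_unit x = (tag x == i)%:R *: weil_unit x.
Proof. by rewrite /weil_unit mulmxA layer_mul // -scalemxAl eq_sym. Qed.

Lemma layer_central M (i : 'I_l) : commutant W M -> M *m layer i = layer i *m M.
Proof.
move=> /commutant_span[c ->]; rewrite mulmx_sumr mulmx_suml.
apply: eq_bigr => x _; rewrite -scalemxAr -scalemxAl; congr (_ *: _).
by rewrite layer_weil_unit weil_unit_layer.
Qed.

(** * Dimensions of the simple submodules *)

Lemma simple_in_layer Y : mxsimple W Y -> exists i : 'I_l, Y *m layer i = Y.
Proof.
move=> simY; have [modY nzY _] := simY; have [P [cP PP PY]] := simple_projection modY.
have YP : Y *m P = Y by have /submxP[D ->] : (Y <= P)%MS; rewrite ?PY // -mulmxA PP.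
have H (i : 'I_l) : exists a : C, Y *m layer i = a *: Y.
  apply: (commutant_eigenvalue simY (layer_commutant i)).
  by rewrite -{1}YP -mulmxA layer_central // mulmxA -PY submxMl.
have [/existsP[i ni]|/existsPn H0] := boolP [exists i : 'I_l, Y *m layer i != 0]; last first.
  case/eqP: nzY; rewrite -[LHS]mulmx1 -sum_layer mulmx_sumr big1 // => i _.
  by apply/eqP; rewrite -[_ == _]negbK.
exists i; have [a ea] := H i.
have : a *: (Y *m layer i) = Y *m layer i.
  by rewrite scalemxAl -ea -mulmxA layer_mul // eqxx scale1r.
move/eqP; rewrite -subr_eq0 -[X in _ - X]scale1r -scalerBl scaler_eq0 (negPf ni) orbF.
by rewrite subr_eq0 ea => /eqP ->; rewrite scale1r.
Qed.

Lemma simple_layer_dim (i : 'I_l) Y : (i.+1 < l)%N -> mxsimple W Y -> Y *m layer i = Y ->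
  (2 * q ^ (l - 1 - i) * \rank Y)%:R =
  q%:R ^+ ((2 * l - 1 - 2 * i) * n) - q%:R ^+ ((2 * l - 3 - 2 * i) * n) :> C.
Proof.
move=> il simY Yi; rewrite -card_twist_index // -trace_layer //.
apply: (simple_rank_orthogonal (rG := W) (X := fun k : twist_index i => scalar_weil (twist k))
  (X' := fun k => scalar_weil (twist k)^-1)) simY Yi.
- exact: layer_commutant.
- by move=> k; apply: scalar_weil_commutant; apply: twist_norm_one.
- by move=> k; apply: layer_scalar_weil; apply: twist_norm_one.
- by move=> k k'; rewrite !scalar_weilM ?twist_norm_one // mulrC.
- by move=> k; rewrite scalar_weilV ?twist_norm_one.
- by move=> k k' kk'; apply: trace_layer_twist.
- by move=> M cM; apply: commutant_span_layer.
Qed.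

Lemma layer_idem i : (i < l)%N -> layer i *m layer i = layer i.
Proof. by move=> il; rewrite layer_mul // eqxx scale1r. Qed.

Lemma exists_simple_image (E : 'M[C]_d) : commutant W E -> E *m E = E -> \tr E != 0 ->
  exists2 Y, mxsimple W Y & Y *m E = Y.
Proof.
move=> cE EE tE; have nE : E != 0 by apply: contraNneq tE => ->; rewrite linear0.
have [Y simY /submxP[D eY]] := dec_mxsimple_exists (commutant_module cE) nE.
by exists Y => //; rewrite eY -mulmxA EE.
Qed.

Lemma exists_simple_layer i : (i < l)%N -> exists2 Y, mxsimple W Y & Y *m layer i = Y.
Proof.
move=> il; apply: exists_simple_image.
- exact: layer_commutant.
- exact: layer_idem.
- exact: trace_layer_neq0.
Qed.

Let N1 := norm_oneN norm_one1.
Let ll : (l.-1 < l)%N. Proof. by rewrite prednK. Qed.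

Lemma last_layer_dim Y : mxsimple W Y -> Y *m layer l.-1 = Y ->
  exists2 eps : C, eps ^+ 2 = 1 &
    Y *m scalar_weil (-1) = eps *: Y /\ (2 * \rank Y)%:R = q%:R ^+ n + eps * weil_parity.
Proof.
move=> simY Yi; rewrite -trace_last_layer -trace_last_layer_parity.
apply: (simple_rank_involution (rG := W)) simY Yi.
- exact: layer_commutant.
- exact: scalar_weil_commutant.
- exact: layer_idem.
- exact: layer_scalar_weil.
- exact: scalar_weil_N1K.
move=> M cM; have [c e] := @commutant_span_layer M (Ordinal ll) cM.
have /imsetP[e0 se0 _] : pi ^+ (2 * l.-1) * 0 \in odd_layer star pi l.-1.
  by apply: imset_f; apply: skew0.
pose k0 : twist_index l.-1 := (true, exist _ (pi ^+ (2 * l.-1) * e0) (imset_f _ se0)).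
exists (fun b => c (b, k0.2)); rewrite e (sum_last_twist k0) big_bool !last_layer_twist /=.
by rewrite scalar_weil1.
Qed.

(** E projects onto the eps-eigenspace of W(-1) in the last layer. Its trace (q^n + eps
    weil_parity)/2 is nonzero since q^(2n) <> 1, so this eigenspace contains a simple submodule. *)
Lemma exists_simple_last_layer (eps : C) : eps ^+ 2 = 1 ->
  exists Y, [/\ mxsimple W Y, Y *m layer l.-1 = Y &
     (2 * \rank Y)%:R = q%:R ^+ n + eps * weil_parity].
Proof.
move=> eps2; pose E := 2^-1 *: (layer l.-1 *m (1%:M + eps *: scalar_weil (-1))).
have n2 : 2 != 0 :> C by rewrite Num.Theory.pnatr_eq0.
have JJ : (1%:M + eps *: scalar_weil (-1)) *m (1%:M + eps *: scalar_weil (-1)) =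
    2 *: (1%:M + eps *: scalar_weil (-1)).
  rewrite mulmxDl !mulmxDr !mul1mx mulmx1 -!scalemxAl -!scalemxAr scalar_weil_N1K scalerA.
  rewrite -expr2 eps2 scale1r [X in _ + X]addrC -mulr2n -scaler_nat.
  by [].
have LJ : layer l.-1 *m (1%:M + eps *: scalar_weil (-1)) =
    (1%:M + eps *: scalar_weil (-1)) *m layer l.-1.
  by rewrite mulmxDl mulmxDr mul1mx mulmx1 -!scalemxAl -!scalemxAr layer_scalar_weil.
have cE : commutant W E.
  apply/commutantZ/commutantM; first exact: layer_commutant.
  by apply: commutantD; [exact: commutant1 | apply/commutantZ/scalar_weil_commutant].
have EE : E *m E = E.
  rewrite /E -scalemxAl -scalemxAr; congr (_ *: _).
  rewrite {2}LJ -mulmxA (mulmxA (_ + _)) JJ -!scalemxAl -LJ -scalemxAr !mulmxA layer_idem //.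
  by rewrite scalerA mulVf // scale1r.
have tE : 2 * \tr E = q%:R ^+ n + eps * weil_parity.
  rewrite /E mxtraceZ mulrA divff // mul1r mulmxDr mxtraceD mulmx1 -scalemxAr mxtraceZ.
  by rewrite trace_last_layer trace_last_layer_parity.
have nE : \tr E != 0.
  apply: contraNneq q_exp_sqr_neq1 => t0; move: tE; rewrite t0 mulr0 => /esym/eqP.
  by rewrite addr_eq0 => /eqP ->; rewrite sqrrN exprMn eps2 weil_parity_sqr mulr1.
have [Y simY YE] := exists_simple_image cE EE nE; have [_ nzY _] := simY.
have YL : Y *m layer l.-1 = Y.
  rewrite -YE -mulmxA; congr (_ *m _); rewrite /E -scalemxAl -mulmxA -LJ.
  by rewrite mulmxA layer_idem.
have YJ : Y *m scalar_weil (-1) = eps *: Y.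
  rewrite -YE -mulmxA scalemxAr; congr (_ *m _).
  rewrite /E -scalemxAl -mulmxA mulmxDl mul1mx -scalemxAl scalar_weil_N1K.
  rewrite [RHS]scalerA [eps * _]mulrC -[RHS]scalerA; congr (_ *: _).
  rewrite [RHS]scalemxAr; congr (_ *m _).
  by rewrite scalerDr scalerA -expr2 eps2 scale1r addrC.
exists Y; split=> //; have [eps' _ [YJ' ->]] := last_layer_dim simY YL.
suff -> : eps' = eps by [].
apply/eqP; rewrite -subr_eq0; have : (eps' - eps) *: Y == 0.
  by rewrite scalerBl -YJ -YJ' subrr.
by rewrite scaler_eq0 (negPf nzY) orbF.
Qed.

Lemma layer_rankP (i : 'I_l) k : (i.+1 < l)%N ->
  (exists Y, [/\ mxsimple W Y, Y *m layer i = Y & \rank Y = k]) <->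
  k%:R = layer_dim q n (l - i).
Proof.
move=> il.
have rankE Y : mxsimple W Y -> Y *m layer i = Y -> (\rank Y)%:R = layer_dim q n (l - i).
  move=> simY Yi; have := simple_layer_dim il simY Yi; rewrite -!natrX => /eqP.
  rewrite -subr_eq opprK -natrD Num.Theory.eqr_nat => /eqP e.
  have q0 : q%:R != 0 :> rat by rewrite Num.Theory.pnatr_eq0 -lt0n ltnW ?q_gt1.
  rewrite /layer_dim (_ : 2 * (l - i) - 1 = 2 * l - 1 - 2 * i)%N; last by lia.
  rewrite (_ : 2 * (l - i) - 3 = 2 * l - 3 - 2 * i)%N; last by lia.
  rewrite (_ : l - i - 1 = l - 1 - i)%N; last by lia.
  apply: (mulIf (x := 2 * q%:R ^+ (l - 1 - i))).
    by rewrite mulf_neq0 ?expf_neq0.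
  rewrite divfK ?mulf_neq0 ?expf_neq0 // -[LHS](addrK (q ^ ((2 * l - 3 - 2 * i) * n))%:R).
  rewrite -!natrX -!natrM -natrD [(\rank Y * _)%N]mulnC e.
  by [].
split=> [[Y [simY Yi <-]]|ek]; first exact: rankE.
have [Y simY Yi] := exists_simple_layer (ltn_ord i); exists Y; split=> //.
by apply/eqP; rewrite -(Num.Theory.eqr_nat rat) ek rankE.
Qed.

(** eps takes both signs: eps = weil_parity gives q^n + 1 and its opposite gives q^n - 1, whatever
    the sign of [weil_parity]. *)
Lemma last_layer_rankP k :
  (exists Y, [/\ mxsimple W Y, Y *m layer l.-1 = Y & \rank Y = k]) <->
  k%:R \in base_dims q n.
Proof.
have pm1 (x : C) : x ^+ 2 = 1 -> x = 1 \/ x = -1.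
  by move=> /eqP; rewrite sqrf_eq1 => /orP[] /eqP; [left|right].
rewrite !inE -natrX; split.
  case=> Y [simY YL <-]; have [eps eps2 [_]] := last_layer_dim simY YL.
  have [|->|->] := pm1 (eps * weil_parity); rewrite ?exprMn ?eps2 ?weil_parity_sqr ?mulr1 //.
    by rewrite -natrX => /natr_double_succ e; apply/orP; left; apply/eqP/natr_half/natr_double_succ.
  by rewrite -natrX => /natr_double_pred e; apply/orP; right; apply/eqP/natr_half/natr_double_pred.
have finish r r' : (2 * r = 2 * r' -> r = r')%N by lia.
case/orP => /eqP/natr_half.
  move/natr_double_succ => ek.
  have [Y [simY YL eY]] := exists_simple_last_layer weil_parity_sqr; exists Y; split=> //.
  apply: finish; rewrite ek; apply/(natr_double_succ C).
  by rewrite eY -expr2 weil_parity_sqr natrX.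
move/natr_double_pred => ek.
have eps2 : (- weil_parity) ^+ 2 = 1 by rewrite sqrrN weil_parity_sqr.
have [Y [simY YL eY]] := exists_simple_last_layer eps2; exists Y; split=> //.
suff e : ((2 * \rank Y).+1 = q ^ n)%N by apply: finish; lia.
apply/(natr_double_pred C); by rewrite eY mulNr -expr2 weil_parity_sqr natrX.
Qed.

Lemma weil_constituent_dims k : irr_constituent_dim W k <-> k%:R \in weil_dims q n l.
Proof.
split=> [/irr_constituent_dimP[Y simY rY]|/weil_dimsP[[j jl ek]|/last_layer_rankP[Y [simY _ rY]]]].
- have [i Yi] := simple_in_layer simY; apply/weil_dimsP.
  have [il|il] := ltnP i.+1 l.
    left; exists (l - i)%N; first by lia.
    by apply/(layer_rankP _ il); exists Y.
  right; apply/last_layer_rankP; exists Y; split=> //.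
  by rewrite (_ : l.-1 = i) //; have := ltn_ord i; lia.
- have il : (l - j < l)%N by lia.
  have [|_ []] := @layer_rankP (Ordinal il) k; first by rewrite /=; lia.
    by rewrite ek /=; congr layer_dim; lia.
  by move=> Y [simY _ rY]; apply/irr_constituent_dimP; exists Y.
- by apply/irr_constituent_dimP; exists Y.
Qed.

(** [average 1] is the identity on the layers i >= 1 and kills layer 0, so only the head of the list
    is lost. *)
Lemma average1_constituent_dims k : (1 < l)%N ->
  (exists Y, [/\ mxsimple W Y, Y *m average 1 = Y & \rank Y = k]) <->
  k%:R \in behead (weil_dims q n l).
Proof.
move=> l1; rewrite behead_weil_dims //; split.
  case=> Y [simY Y1 rY]; have [i Yi] := simple_in_layer simY; apply/weil_dimsP.
  have i0 : (0 < i)%N.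
    rewrite lt0n; apply/negP => /eqP ei; have [_ nzY _] := simY; case/eqP: nzY.
    by rewrite -Yi -Y1 -mulmxA average_layer // ei scale0r mulmx0.
  have [il|il] := ltnP i.+1 l.
    left; exists (l - i)%N; first by lia.
    by apply/(layer_rankP _ il); exists Y.
  right; apply/last_layer_rankP; exists Y; split=> //.
  by rewrite (_ : l.-1 = i) //; have := ltn_ord i; lia.
have inv Y i : (0 < i < l)%N -> Y *m layer i = Y -> Y *m average 1 = Y.
  by case/andP=> i0 il Yi; rewrite -Yi -mulmxA layer_average // i0 scale1r.
case/weil_dimsP => [[j jl ek]|/last_layer_rankP[Y [simY Yi rY]]]; last first.
  by exists Y; split=> //; apply: inv Yi; lia.
have il : (l - j < l)%N by lia.
have [|_ []] := @layer_rankP (Ordinal il) k; first by rewrite /=; lia.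
  by rewrite ek /=; congr layer_dim; lia.
by move=> Y [simY Yi rY]; exists Y; split=> //; apply: inv Yi; rewrite /=; lia.
Qed.

Lemma layer0_constituent_dims k : (1 < l)%N ->
  (exists Y, [/\ mxsimple W Y, Y *m layer 0 = Y & \rank Y = k]) <->
  k%:R = layer_dim q n l.
Proof. by move=> l1; have := @layer_rankP (Ordinal l_gt0) k l1; rewrite /= subn0. Qed.

Lemma rank_layer0 : (1 < l)%N ->
  (\rank (layer 0))%:R / #|norm_one star|%:R = layer_dim q n l :> rat.
Proof.
move=> l1; have : (\rank (layer 0))%:R = \tr (layer 0).
  by rewrite mxtrace_idempotent // layer_idem.
rewrite trace_layer // muln0 !subn0 -!natrX => /eqP.
rewrite eq_sym subr_eq -natrD Num.Theory.eqr_nat => /eqP e.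
by rewrite /layer_dim (card_norm_one chainA) -!natrX e natrD addrK natrM.
Qed.

Lemma average1_layer0 : (1 < l)%N -> average 1 + layer 0 = 1%:M.
Proof. by move=> l1; rewrite /layer l1 average0 addrC subrK. Qed.

End WeilLayers.

(** * The quotients of the ramified extension *)

Section RamifiedExtension.

Variables (O : idomainType) (s : O).
Local Notation P := (ramified s).
Local Notation t := ('qX : P).
Local Notation c := (@qpolyC O ('X^2 - s%:P)).

(** Arithmetic in [{poly %/ p}] is modulo [mk_monic p], which is p itself for this monic p. *)
Lemma mk_monic_ramified : mk_monic ('X^2 - s%:P) = 'X^2 - s%:P.
Proof.
have sz : size ('X^2 - s%:P : {poly O}) = 3%N.
  by rewrite size_polyDl size_polyXn // size_polyN size_polyC; case: (s == 0).
rewrite /mk_monic sz /= monicE lead_coefDl ?lead_coefXn ?eqxx //.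
by rewrite size_polyXn size_polyN size_polyC; case: (s == 0).
Qed.

Lemma size_mk_monic_ramified : size (mk_monic ('X^2 - s%:P : {poly O})) = 3%N.
Proof.
rewrite mk_monic_ramified size_polyDl size_polyXn // size_polyN size_polyC.
by case: (s == 0).
Qed.

Lemma qpolyC_in x : c x = in_qpoly _ x%:P.
Proof.
apply: val_inj; rewrite /= Pdiv.CommonRing.rmodp_small // size_mk_monic_ramified size_polyC.
by case: (x == 0).
Qed.

Lemma qX_sqr : t * t = c s.
Proof.
rewrite qpolyC_in -rmorphM -expr2.
transitivity (in_qpoly ('X^2 - s%:P) ('X^2 - s%:P) + in_qpoly ('X^2 - s%:P) s%:P).
  by rewrite -rmorphD subrK.
rewrite -[RHS]add0r; congr (_ + _); apply: val_inj.
by have := Pdiv.RingMonic.rmodpp (monic_mk_monic ('X^2 - s%:P)); rewrite {1}mk_monic_ramified.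
Qed.

Lemma linear_poly_small (x y : O) :
  (size (x%:P + y *: 'X)%R < size (mk_monic ('X^2 - s%:P)%R))%N.
Proof.
rewrite size_mk_monic_ramified.
apply: leq_ltn_trans (size_polyD _ _) _; rewrite gtn_max size_polyC.
apply/andP; split; first by case: (x == 0).
by apply: leq_ltn_trans (size_scale_leq _ _) _; rewrite size_polyX.
Qed.

Lemma ramifiedE x y : c x + c y * t = in_qpoly _ (x%:P + y *: 'X).
Proof. by rewrite !qpolyC_in -rmorphM -rmorphD mul_polyC. Qed.

Lemma ramified_decomposition (z : P) : exists x y, z = c x + c y * t.
Proof.
exists (z : {poly O})`_0, (z : {poly O})`_1; rewrite ramifiedE; apply: val_inj.
have sz := leq_trans (size_mk_monic z) (eq_leq size_mk_monic_ramified).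
rewrite /= Pdiv.CommonRing.rmodp_small; last first.
  exact: linear_poly_small.
apply/polyP => i; rewrite coefD coefC coefZ coefX.
case: i => [|[|i]] /=; rewrite ?mulr0n ?mulr1n ?mulr0 ?mulr1 ?addr0 ?add0r //.
by rewrite nth_default //; apply: (@leq_trans 2).
Qed.

Lemma ramified_eq0 x y : c x + c y * t = 0 -> x = 0 /\ y = 0.
Proof.
rewrite ramifiedE => /(congr1 val) /=.
rewrite Pdiv.CommonRing.rmodp_small => [/polyP e|]; last first.
  exact: linear_poly_small.
split; [have := e 0%N | have := e 1%N];
  by rewrite coefD coefC coefZ coefX coef0 /= ?mulr0n ?mulr1n ?mulr0 ?mulr1 ?addr0 ?add0r.
Qed.

Lemma qX_exp_even k : t ^+ (2 * k) = c (s ^+ k).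
Proof. by rewrite exprM (_ : t ^+ 2 = c s) ?rmorphXn //; apply: qX_sqr. Qed.

End RamifiedExtension.

Section QuotientRings.

Variables (O : idomainType) (s : O).
Hypothesis not_fieldO : ~ GRing.field_axiom O.
Hypothesis maxO : maximal_ideal (multiples s).
Variables (F : finFieldType) (res : {rmorphism O -> F}).
Hypothesis resP : quotient_map (multiples s) res.
Hypothesis odd_char : 2%N \notin [pchar F].
Variable l : nat.
Hypothesis l_gt0 : (0 < l)%N.
Variables (R : finComUnitRingType) (prR : {rmorphism O -> R}).
Hypothesis prRP : quotient_map (multiples (s ^+ l)) prR.
Variables (A : finComUnitRingType) (prA : {rmorphism ramified s -> A}).
Hypothesis prAP : quotient_map (multiples (('qX : ramified s) ^+ (2 * l - 1))) prA.
Variable iota : {rmorphism R -> A}.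
Hypothesis iotaP : forall x : O, iota (prR x) = prA (qpolyC _ x).
Variable star : {rmorphism A -> A}.
Hypothesis starR : forall r : R, star (iota r) = iota r.
Hypothesis star_pi : star (prA 'qX) = - prA 'qX.

Local Notation pi := (prA 'qX).
Local Notation c := (@qpolyC O ('X^2 - s%:P)).

Lemma multiples_s_proper : ~ multiples s 1.
Proof. by case: maxO. Qed.

(** If s = 0, maximality of the zero ideal makes every nonzero element a unit, and O would be a
    field. *)
Lemma uniformizer_neq0 : s != 0.
Proof.
apply/eqP => s0; apply: not_fieldO => x nx.
have [U|nU] := boolP (x \is a GRing.unit); first by [].
suff [y e] : multiples s x by rewrite e s0 mulr0 eqxx in nx.
have [_ _ maxx] := maxO; apply: (maxx (multiples x)).
- split=> [|_ _ [y ->] [z ->]|a _ [y ->]]; first by exists 0; rewrite mul0r.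
    by exists (y + z); rewrite mulrDl.
  by exists (a * y); rewrite mulrA.
- by case=> y e; case/negP: nU; apply/unitrP; exists y; split; last rewrite mulrC; rewrite -e.
- by move=> _ [z ->]; exists 0; rewrite s0 mulr0 mul0r.
- by exists 1; rewrite mul1r.
Qed.

Lemma pi_sqr : pi ^+ 2 = iota (prR s).
Proof. by rewrite iotaP expr2 -rmorphM qX_sqr. Qed.

Lemma A_decomposition a : exists x y, a = iota (prR x) + iota (prR y) * pi.
Proof.
have [surj _] := prAP; have [z <-] := surj a.
have [x [y ->]] := ramified_decomposition z; exists x, y.
by rewrite !iotaP -rmorphM -rmorphD.
Qed.

Lemma pi_nilpotent : pi ^+ (2 * l - 1) = 0.
Proof. by have [_ H] := prAP; rewrite -rmorphXn; apply/H; exists 1; rewrite mul1r. Qed.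

Lemma uniformizer_expS : s ^+ l = s * s ^+ l.-1.
Proof. by rewrite -exprS prednK. Qed.

(** Since t^(2l-1) = s^(l-1) t, this describes the ideal in the basis 1, t. Comparing coefficients
    of 1 then yields [pi_top] and [iota_inj]. *)
Lemma top_multiple (z : ramified s) : exists x y,
  z * 'qX ^+ (2 * l - 1) = c (x * s ^+ l) + c (y * s ^+ l.-1) * 'qX.
Proof.
have [x [y ->]] := ramified_decomposition z; exists y, x.
have -> : (2 * l - 1 = (2 * l.-1).+1)%N by lia.
rewrite (exprS ('qX : ramified s)) qX_exp_even uniformizer_expS.
transitivity (c x * 'qX * c (s ^+ l.-1) + c y * ('qX * 'qX) * c (s ^+ l.-1)); first by ring.
by rewrite qX_sqr !rmorphM /=; ring.
Qed.

Lemma pi_top : pi ^+ (2 * l - 2) != 0.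
Proof.
apply/eqP; rewrite -rmorphXn; have [_ H] := prAP; move/H => [z e].
have [x [y ez]] := top_multiple z; rewrite ez in e.
have {}e : c (s ^+ l.-1 - x * s ^+ l) + c (- (y * s ^+ l.-1)) * 'qX = 0.
  rewrite rmorphB rmorphN /= mulNr addrAC -qX_exp_even (_ : 2 * l.-1 = 2 * l - 2)%N; last by lia.
  by rewrite e; ring.
have [/eqP + _] := ramified_eq0 e.
rewrite uniformizer_expS mulrA -{1}[s ^+ l.-1]mul1r -mulrBl mulf_eq0.
rewrite expf_eq0 (negPf uniformizer_neq0) andbF orbF subr_eq0 => /eqP e1.
by apply: multiples_s_proper; exists x.
Qed.

Lemma iota_inj : injective iota.
Proof.
move=> r r' /eqP; rewrite -subr_eq0 -rmorphB => /eqP e; apply/eqP; rewrite -subr_eq0.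
move: (r - r') e => {r r'} r; have [surj H] := prRP; have [x <-] := surj r.
rewrite iotaP; have [_ HA] := prAP => /HA[z]; have [y [y' ->]] := top_multiple z => e.
have {}e : c (x - y * s ^+ l) + c (- (y' * s ^+ l.-1)) * 'qX = 0.
  by rewrite rmorphB rmorphN /= e; ring.
have [/eqP + _] := ramified_eq0 e; rewrite subr_eq0 => /eqP ->.
by apply/eqP/H; exists y.
Qed.

(** A lift x' of the inverse residue gives x x' = 1 + y s, and s is nilpotent in A. *)
Lemma res_unit x : res x != 0 -> iota (prR x) \is a GRing.unit.
Proof.
move=> nx; have [surj H] := resP; have [x' ex'] := surj (res x)^-1.
have /H[y ey] : res (x * x' - 1) = 0 by rewrite rmorphB rmorphM rmorph1 /= ex' divff ?subrr.
have : iota (prR x) * iota (prR x') \is a GRing.unit.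
  have exx : x * x' = 1 + y * s by rewrite -ey addrC subrK.
  rewrite -!rmorphM exx !rmorphD !rmorph1 !rmorphM /=.
  apply: (@unit_add_nilpotent _ _ _ (2 * l - 1)); first exact: unitr1.
  by rewrite -pi_sqr exprMn -(exprM pi) (mulnC 2 (2 * l - 1)%N) (exprM pi) pi_nilpotent expr2 !mulr0.
by rewrite unitrM => /andP[].
Qed.

Lemma residue_surj (a : F) : exists x, res x == a.
Proof. by have [surj _] := resP; have [x <-] := surj a; exists x. Qed.

Definition digit (a : F) : A := iota (prR (xchoose (residue_surj a))).

Lemma two_unit : (2 : A) \is a GRing.unit.
Proof.
rewrite -(rmorph_nat iota 2) -(rmorph_nat prR 2); apply: res_unit.
by rewrite rmorph_nat; apply: contra odd_char => e; rewrite inE.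
Qed.

Lemma ramified_chain_quotient : ramified_chain star pi l digit.
Proof.
split=> //.
- exact: pi_nilpotent.
- exact: pi_top.
- move=> a; have [x [y ->]] := A_decomposition a.
  by rewrite !(rmorphD, rmorphM) /= !starR star_pi rmorphN /= star_pi opprK.
- exact: two_unit.
- by move=> a; apply: starR.
- move=> a a' aa; rewrite /digit -!rmorphB; apply: res_unit.
  by rewrite rmorphB !(eqP (xchooseP (residue_surj _))) subr_eq0.
- move=> a; have [x [y ->]] := A_decomposition a.
  have [_ H] := resP.
  have /H[z ez] : res (x - xchoose (residue_surj (res x))) = 0.
    by rewrite rmorphB (eqP (xchooseP (residue_surj _))) subrr.
  exists (res x), (iota (prR y) + iota (prR z) * pi).
  rewrite -[x in LHS](subrK (xchoose (residue_surj (res x)))) ez !rmorphD !rmorphM /=.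
  by rewrite -pi_sqr -/(digit _); ring.
Qed.

Let chainA := ramified_chain_quotient.

(** * The half trace and the character of A *)

Definition half_trace (a : A) : R := odflt 0 [pick r | iota r == (a + star a) / 2].

Lemma half_traceE a : iota (half_trace a) = (a + star a) / 2.
Proof.
rewrite /half_trace; case: pickP => [r /eqP //|H].
have [x [y ea]] := A_decomposition a; have := H (prR x); rewrite ea.
rewrite rmorphD rmorphM /= !starR star_pi mulrN addrACA subrr addr0.
by rewrite (double_half chainA) eqxx.
Qed.

Lemma half_traceD a b : half_trace (a + b) = half_trace a + half_trace b.
Proof. by apply: iota_inj; rewrite rmorphD !half_traceE rmorphD -mulrDl addrACA. Qed.

Lemma half_trace_star a : half_trace (star a) = half_trace a.
Proof. by apply: iota_inj; rewrite !half_traceE (chain_starK chainA) addrC. Qed.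

Lemma half_traceZ r a : half_trace (iota r * a) = r * half_trace a.
Proof.
by apply: iota_inj; rewrite rmorphM !half_traceE rmorphM /= starR -mulrDr mulrA.
Qed.

Lemma half_trace0 : half_trace 0 = 0.
Proof. by apply: iota_inj; rewrite half_traceE !rmorph0 addr0 mul0r. Qed.

(** Testing a = 1 leaves b in R pi, so b is skew and, if nonzero, of odd valuation; testing a = pi
    gives pi b = 0, which would force the even valuation 2l-2. *)
Lemma half_trace_nondeg b : (forall a, half_trace (a * b) = 0) -> b = 0.
Proof.
move=> H; have [x [y eb]] := A_decomposition b.
have b0 : b = iota (prR y) * pi.
  have := H 1; rewrite mul1r => /(congr1 iota); rewrite half_traceE rmorph0 {1 2}eb.
  rewrite rmorphD rmorphM /= !starR star_pi mulrN addrACA subrr addr0.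
  by rewrite (double_half chainA) => e; rewrite eb e add0r.
have pb : pi * b = 0.
  have := congr1 iota (H pi); rewrite half_traceE rmorph0 b0 !rmorphM /= starR star_pi.
  rewrite (_ : - pi * _ = pi * (iota (prR y) * pi)); last by ring.
  by rewrite (double_half chainA).
have sb : b \in skew star by apply/skewP; rewrite b0 rmorphM /= starR star_pi mulrN.
apply/eqP; apply: contraT => /(pi_valuation chainA)[k [u [kl Uu eb']]].
have ok : odd k by apply: (skew_odd chainA kl Uu); rewrite -eb'.
have := pi_exp_mul_eq0 chainA (k := k.+1) Uu; rewrite exprS -mulrA -eb' => /(_ pb).
by lia.
Qed.

Variables (C : fieldType) (lam : R -> C).
Hypothesis lamP : primitive_character lam.

Definition half_trace_character (a : A) : C := lam (half_trace a).

(** Otherwise the half traces of the multiples of b form an ideal on which lam is trivial, hence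
    zero. *)
Lemma half_trace_character_nondeg b : b != 0 ->
  exists a, half_trace_character (a * b) != 1.
Proof.
move=> nb; have [/existsP//|/existsPn H] := boolP [exists a, half_trace_character (a * b) != 1].
have [_ _ prim] := lamP.
case/eqP: nb; apply: half_trace_nondeg => a.
apply: (prim (fun r => exists a, r = half_trace (a * b))); last by exists a.
- split=> [|_ _ [x ->] [y ->]|r _ [x ->]].
  + by exists 0; rewrite mul0r half_trace0.
  + by exists (x + y); rewrite mulrDl half_traceD.
  + by exists (iota r * x); rewrite -mulrA half_traceZ.
- by move=> _ [x ->]; have := H x; rewrite negbK => /eqP.
Qed.

End QuotientRings.

Theorem theorem6p3
  (O : idomainType) (s : O)
  (pidO : principal_ideal_ring O)
  (not_fieldO : ~ GRing.field_axiom O)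
  (localO : local_with_maximal_ideal (multiples s))
  (Fq : finFieldType) (res : {rmorphism O -> Fq})
  (resP : quotient_map (multiples s) res)
  (odd_char : 2%N \notin [pchar Fq])
  (l : nat) (l_ge1 : (1 <= l)%N)
  (R : finComUnitRingType) (prR : {rmorphism O -> R})
  (prRP : quotient_map (multiples (s ^+ l)) prR)
  (A : finComUnitRingType) (prA : {rmorphism ramified s -> A})
  (prAP : quotient_map (multiples (('qX : ramified s) ^+ (2 * l - 1))) prA)
  (iota : {rmorphism R -> A})
  (iotaP : forall x : O, iota (prR x) = prA (qpolyC _ x))
  (star : {rmorphism A -> A})
  (starR : forall r : R, star (iota r) = iota r)
  (star_pi : star (prA 'qX) = - prA 'qX)
  (n : nat) (n_ge1 : (1 <= n)%N)
  (V : finLmodType A) (freeV : free_of_rank V (2 * n))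
  (h : V -> V -> A) (hP : nondegenerate_skew_hermitian star h)
  (C : numClosedFieldType)
  (lam : R -> C) (lamP : primitive_character lam)
  (d : nat) (S : R * V -> 'M[C]_d)
  (SP : schroedinger_repr (alternating_part iota star h) lam S)
  (W : mx_representation C (unitary_group h) d)
  (WP : weil_repr S W) :
  let q := #|Fq| in
  let pi := prA 'qX in
  let Top := Top_repr pi l WP in
  let Bot := Bot_repr pi l WP in
  let dim_Top_over_N : rat := (dim_Top S pi l)%:R / #|norm_one star|%:R in
  (forall k : nat, irr_constituent_dim W k <-> k%:R \in weil_dims q n l)
  /\ (l = 1%N ->
      forall k : nat, irr_constituent_dim W k <-> k%:R \in base_dims q n)
  /\ ((1 < l)%N ->
      [/\ dim_Top_over_N = layer_dim q n l,
          forall k : nat, irr_constituent_dim Top k <-> k%:R = dim_Top_over_N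
        & forall k : nat,
            irr_constituent_dim Bot k <-> k%:R \in behead (weil_dims q n l)]).
Proof.
move=> q pi Top' Bot' dim_Top'.
have [maxO _] := localO; have [lam0 lamD _] := lamP.
have chainA := ramified_chain_quotient not_fieldO maxO resP odd_char l_ge1 prAP iotaP starR star_pi.
(* Composing lam with the half trace turns lam (f u v) into psi (h u v), so the rest involves A and
   h only. *)
pose psi : A -> C := half_trace_character iota star lam.
have psi0 : psi 0 = 1.
  by rewrite /psi /half_trace_character
    (half_trace0 not_fieldO maxO resP odd_char l_ge1 prRP prAP iotaP starR star_pi).
have psiD a b : psi (a + b) = psi a * psi b.
  by rewrite /psi /half_trace_character
    (half_traceD not_fieldO maxO resP odd_char l_ge1 prRP prAP iotaP starR star_pi).
have psi_star a : psi (star a) = psi a.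
  by rewrite /psi /half_trace_character
    (half_trace_star not_fieldO maxO resP odd_char l_ge1 prRP prAP iotaP starR star_pi).
have psi_nondeg (b : A) : b != 0 -> exists a, psi (a * b) != 1.
  exact: (half_trace_character_nondeg not_fieldO maxO resP odd_char l_ge1 prRP prAP
    iotaP starR star_pi lamP).
have [T0 SM Slam d_gt0 S_irr] := SP.
pose T v := S (0, v).
have S_T r v : S (r, v) = lam r *: T v.
  have := SM (r, 0) (0, v); rewrite /heisenberg_mul /= addr0 add0r Slam mul_mx_scalar.
  rewrite /alternating_part (herm0l hP) -/(half_trace iota star 0).
  by rewrite (half_trace0 not_fieldO maxO resP odd_char l_ge1 prRP prAP iotaP starR star_pi) addr0.
have TD u v : T v *m T u = psi (h u v) *: T (u + v).
  by rewrite -SM /heisenberg_mul /= !add0r S_T.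
have T_irr (M : 'M[C]_d) : (forall v, (M *m T v <= M)%MS) -> M != 0 -> row_full M.
  by move=> MT; apply: S_irr => -[r v]; rewrite S_T -scalemxAr scalemx_sub.
have W_T (g : {perm V}) v : g \in unitary_group h -> invmx (W g) *m T v *m W g = T (g v).
  by move=> Gg; exact (WP g Gg 0 v).
have dimW := weil_constituent_dims chainA n_ge1 freeV hP psi0 psiD psi_star psi_nondeg
  d_gt0 T0 TD T_irr W_T.
split; first exact: dimW.
split=> [l1 k|l1].
  have -> : base_dims q n = weil_dims q n l by rewrite l1.
  exact: dimW.
(* E and L are complementary projections, and Bot is the image of E. Hence Top is isomorphic to the
   image of L, the layer 0. *)
pose E := average pi l T 1; pose L := layer pi l T 0.
have EE : E *m E = E by rewrite /E (average_mul chainA n_ge1 hP psi0 d_gt0 TD).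
have LL : L *m L = L by rewrite /L (layer_idem chainA n_ge1 hP psi0 d_gt0 TD).
have LE : L *m E = 0 by rewrite /E /L (layer_average chainA n_ge1 hP psi0 d_gt0 TD) // scale0r.
have EL : E + L = 1%:M by rewrite /E /L (average1_layer0 chainA).
have layerE : scaled_submodule V (pi ^+ (2 * l - 2)) = isotropic_layer pi l V 1.
  by rewrite /isotropic_layer; congr (scaled_submodule V (pi ^+ _)); lia.
have BotP m (M : 'M_(m, d)) : (M <= Bot S pi l)%MS <-> M *m E = M.
  rewrite /Bot layerE; split=> [/fixed_mxP fixM|ME]; first exact: average_fix.
  apply/fixed_mxP => w Vw; rewrite -ME -mulmxA.
  by rewrite [E *m _](average_T chainA n_ge1 hP psi0 d_gt0 TD).
have BotE : (Bot S pi l :=: E)%MS.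
  apply/eqmxP/andP; split; last exact/BotP.
  by have /BotP <- := submx_refl (Bot S pi l); apply: submxMl.
have LBot0 : (L :&: Bot S pi l = 0)%MS.
  have /BotP <- : (L :&: Bot S pi l <= Bot S pi l)%MS by apply: capmxSr.
  by have /submxP[D ->] := capmxSl L (Bot S pi l); rewrite -mulmxA LE mulmx0.
have LBot1 : (L + Bot S pi l :=: 1%:M)%MS.
  apply/eqmxP; rewrite submx1 /= -EL addrC.
  by apply: addmx_sub_adds => //; rewrite BotE.
have modL : mxmodule W L by apply: commutant_module; apply: layer_commutant.
have dimTop : dim_Top S pi l = \rank L.
  apply: (@addIn (\rank (Bot S pi l))); rewrite /dim_Top mxrank_coker subnK ?rank_leq_row //.
  rewrite -[LHS](mxrank1 C) -LBot1 (mxdirectP _) //=.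
  exact/mxdirect_addsP.
have dimE : dim_Top' = layer_dim q n l.
  rewrite /dim_Top' dimTop.
  exact: (rank_layer0 chainA n_ge1 freeV hP psi0 psiD psi_star psi_nondeg d_gt0 T0 TD T_irr).
split=> [|k|k]; first exact: dimE.
- have sim := mx_rsim_factmod modL (Bot_module pi l WP) LBot1.
  rewrite dimE -(layer0_constituent_dims chainA n_ge1 freeV hP psi0 psiD psi_star psi_nondeg
    d_gt0 T0 TD T_irr W_T k l1).
  have imL Y : (Y <= L)%MS <-> Y *m L = Y.
    by split=> [/submxP[D ->]|<-]; rewrite ?submxMl // -mulmxA LL.
  split=> [/irr_constituent_dimP|[Y [simY YL rY]]].
    move/(simple_rsim (sim _)); case; first exact/mxdirect_addsP.
    move=> Y simY rY; have [Y' [? /imL ? ?]] : exists Y', [/\ mxsimple W Y', (Y' <= L)%MS & \rank Y' = k].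
      by apply/simple_submod; exists Y.
    by exists Y'.
  apply/irr_constituent_dimP; apply: (simple_rsim (mx_rsim_sym (sim _))).
    exact/mxdirect_addsP.
  by apply/simple_submod; exists Y; split=> //; apply/imL.
rewrite -(average1_constituent_dims chainA n_ge1 freeV hP psi0 psiD psi_star psi_nondeg
  d_gt0 T0 TD T_irr W_T k l1).
split=> [/irr_constituent_dimP/simple_submod[Y [? /BotP ? ?]]|[Y [? ? ?]]]; first by exists Y.
by apply/irr_constituent_dimP/simple_submod; exists Y; split=> //; apply/BotP.
Qed.
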